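(* Let $X$ be a Banach space, let $(e_n)_n$ be a $\xi$-spreading model of $X$, for some $1\le\xi<\omega_1$, and let $E$ be the space generated by $(e_n)_n$. If $E$ contains an isomorphic copy of $\ell^1$ (resp. $c_0$), then $X$ admits the usual basis of $\ell^1$ (resp. $c_0$) as a $(\xi+1)$-spreading model.
   Context: $\mathbb{N}=\{1,2,\dots\}$. For $M\subseteq\mathbb{N}$ infinite, $M(k)$ is its $k$-th element; for a finite set $s$, $s(k)$ is its $k$-th element; $t\sqsubseteq s$ means initial segment. For a family $\mathcal{F}$ of finite subsets of $\mathbb{N}$ let $\widehat{\mathcal{F}}=\{t:\exists s\in\mathcal{F},\ t\sqsubseteq s\}$ and $\mathcal{F}\upharpoonright M=\{s\in\mathcal{F}:s\subseteq M\}$. $\mathcal{F}$ is thin if no element is a proper initial segment of another. A family is regular if it is hereditary (closed under subsets), spreading (if $\{n_1<\dots<n_k\}$ is in it, $m_1<\dots<m_k$, $n_i\le m_i$ for all $i$, then $\{m_1,\dots,m_k\}$ is in it) and compact (its characteristic functions form a closed subset of $\{0,1\}^{\mathbb{N}}$). $\mathcal{F}$ is regular thin if it is thin and $\widehat{\mathcal{F}}$ is regular. The order $o(\mathcal{F})$ is the (countable) rank of the well-founded tree $\widehat{\mathcal{F}}$: maximal elements have rank $0$, the rank of $s$ is $\sup\{\mathrm{rank}(t)+1: t\in\widehat{\mathcal{F}},\ s\sqsubset t\}$, and $o(\mathcal{F})$ is the rank of $\emptyset$. A tuple $(s_1,\dots,s_l)$ of nonempty finite subsets of $\mathbb{N}$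 is plegma if $s_i(k)<s_j(k)$ whenever $i<j$ and $k\le\min(|s_i|,|s_j|)$, and $s_i(k)<s_j(k+1)$ for all $i,j$ and $k\le\min(|s_i|,|s_j|-1)$. An $\mathcal{F}$-subsequence $(x_s)_{s\in\mathcal{F}\upharpoonright M}$ in $X$ ($M\subseteq\mathbb{N}$ infinite) is a map $s\mapsto x_s$ from $\mathcal{F}\upharpoonright M$ to $X$. Let $(e_n)_n$ be a Hamel basis of an infinite-dimensional seminormed space with seminorm $\|\cdot\|_*$. $(x_s)_{s\in\mathcal{F}\upharpoonright M}$ generates $(e_n)_n$ as an $\mathcal{F}$-spreading model if there is a null sequence $(\delta_n)_n$ of positive reals such that $\big|\,\|\sum_{j=1}^k a_jx_{s_j}\|-\|\sum_{j=1}^k a_je_j\|_*\big|\le\delta_l$ for all $1\le k\le l$, all plegma $k$-tuples $(s_j)_{j=1}^k$ in $\mathcal{F}\upharpoonright M$ with $s_1(1)\ge M(l)$ and all $a_1,\dots,a_k\in[-1,1]$. For $1\le\xi<\omega_1$, $(e_n)_n$ is a $\xi$-spreading model of $X$ (and $X$ admits $(e_n)_n$ as a $\xi$-spreading model) if it is generated by some $\mathcal{F}$-subsequence in $X$ with $\mathcal{F}$ regular thin and $o(\mathcal{F})=\xi$. The space generated by $(e_n)_n$ is the Banach space obtained by completing the span of $(e_n)_n$ (modulo the kernel of the seminorm). *)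

(* Defs.v *)
From HB Require Import structures.
From mathcomp Require Import all_boot all_order all_algebra finmap.
From mathcomp Require Import all_classical all_reals all_analysis.
Set Implicit Arguments.
Unset Strict Implicit.
Unset Printing Implicit Defensive.
Import Order.TTheory GRing.Theory Num.Theory.
Import numFieldNormedType.Exports.
Local Open Scope classical_set_scope.
Local Open Scope ring_scope.

(* Notations for countable ordinals: [Olsup f] denotes the least ordinal
   strictly above every ordinal [a] such that [f n = Some a] for some [n].
   The countable ordinals are exactly the values of these notations, and two
   notations have the same value iff they are related by [oeq]. *)
Inductive cord : Type := Olsup of (nat -> option cord).

Fixpoint ole (a b : cord) {struct a} : Prop :=
  let: Olsup f := a in let: Olsup g := b in
  forall n, match f n with
            | None => True
            | Some a' => exists m, match g m with
                                   | None => False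
                                   | Some b' => ole a' b'
                                   end
            end.

Definition oeq (a b : cord) := ole a b /\ ole b a.

Definition ozero : cord := Olsup (fun=> None).
Definition osucc (a : cord) : cord := Olsup (fun=> Some a).

Lemma ole_refl a : ole a a.
Proof.
move: a; fix IH 1 => -[f] n /=; case E: (f n) => [a|//].
by exists n; rewrite E; apply: IH.
Qed.

Lemma ole_trans a b c : ole a b -> ole b c -> ole a c.
Proof.
move: a b c; fix IH 1 => -[f] [g] [h] /= fg gh n.
have {fg} := fg n; case: (f n) => [a|//] [m].
have {gh} := gh m; case: (g m) => [b|//] [p hp] ab.
by exists p; case: (h p) hp => [c|//]; apply: IH ab.
Qed.

Lemma ole_osucc a b : ole a b -> ole a (osucc b).
Proof.
move: a b; fix IH 1 => -[f] [g] /= fg n.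
have {fg} := fg n; case: (f n) => [a|//] [m gm].
exists 0%N; case E: (g m) gm => [b|//] ab.
have abS := IH a b ab.
case: a ab abS => fa ab abS k; have {abS} := abS k.
by case: (fa k) => [a'|//] [_ a'b]; exists m; rewrite E.
Qed.

(* [Olsup f <= c] iff every ordinal listed by [f] is strictly below [c], that
   is, has its successor below [c]. *)
Lemma ole_OlsupP f c :
  ole (Olsup f) c <-> (forall n a, f n = Some a -> ole (osucc a) c).
Proof.
case: c => h; split=> [fc n a fn _ /=|fc n /=].
  by have := fc n; rewrite fn.
by case E: (f n) => [a|//]; have /= := fc n a E 0%N.
Qed.

(* Finite subsets of N = {1, 2, ...} are represented by finite sets of [nat]
   not containing 0, see [positive_family]. *)
Definition pos_nat : set nat := [set n | (0 < n)%N].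

(* s(k), for 1 <= k <= #|s| *)
Definition felt (s : {fset nat}) (k : nat) : nat :=
  nth 0%N (sort leq s) k.-1.

(* M(k), for 1 <= k: the element m of M such that M has exactly k elements in
   {1, ..., m} *)
Definition selt (M : set nat) (k : nat) : nat :=
  xget 0%N [set m | M m /\ (\sum_(1 <= j < m.+1) (j \in M : nat) = k)%N].

Definition initial_segment (t s : {fset nat}) : Prop :=
  (t `<=` s)%fset /\
  (forall m n, m \in t -> n \in s -> (n <= m)%N -> n \in t).

Definition proper_initial_segment (t s : {fset nat}) : Prop :=
  initial_segment t s /\ t <> s.

Definition positive_family (F : set {fset nat}) : Prop :=
  forall s, F s -> [set` s] `<=` pos_nat.

Definition hat (F : set {fset nat}) : set {fset nat} :=
  [set t | exists2 s, F s & initial_segment t s].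

Definition restrict_family (F : set {fset nat}) (M : set nat) :
    set {fset nat} :=
  [set s | F s /\ [set` s] `<=` M].

Definition thin (F : set {fset nat}) : Prop :=
  forall s t, F s -> F t -> ~ proper_initial_segment s t.

Definition hereditary (G : set {fset nat}) : Prop :=
  forall s t, G s -> (t `<=` s)%fset -> G t.

Definition spreading (G : set {fset nat}) : Prop :=
  forall s t, G s -> [set` t] `<=` pos_nat -> #|` s| = #|` t| ->
    (forall k, (1 <= k <= #|` s|)%N -> (felt s k <= felt t k)%N) -> G t.

(* The coordinate 0 is constantly [false] on positive families, so closedness
   in {0,1}^nat amounts to closedness in {0,1}^N. *)
Definition char_fun (s : {fset nat}) : cantor_space := fun n => n \in s.

Definition compact_family (G : set {fset nat}) : Prop :=
  closed (char_fun @` G).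

Definition regular (G : set {fset nat}) : Prop :=
  [/\ hereditary G, spreading G & compact_family G].

Definition regular_thin (F : set {fset nat}) : Prop :=
  [/\ positive_family F, thin F & regular (hat F)].

Definition is_osup (A : set cord) (a : cord) : Prop :=
  (forall b, A b -> ole b a) /\
  (forall c, (forall b, A b -> ole b c) -> ole a c).

Definition is_rank (T : set {fset nat}) (rk : {fset nat} -> cord) : Prop :=
  forall s, T s ->
    is_osup [set osucc (rk t) | t in [set t | T t /\ proper_initial_segment s t]]
            (rk s).

(* o(F) = xi *)
Definition has_order (F : set {fset nat}) (xi : cord) : Prop :=
  hat F fset0 /\
  exists rk, is_rank (hat F) rk /\ oeq (rk fset0) xi.

Definition plegma (l : nat) (s : l.-tuple {fset nat}) : Prop :=
  [/\ forall i, tnth s i != fset0,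
      forall (i j : 'I_l) k, (i < j)%N ->
        (1 <= k <= minn #|` tnth s i| #|` tnth s j|)%N ->
        (felt (tnth s i) k < felt (tnth s j) k)%N
    & forall (i j : 'I_l) k,
        (1 <= k <= minn #|` tnth s i| (#|` tnth s j| - 1))%N ->
        (felt (tnth s i) k < felt (tnth s j) k.+1)%N].

Section SpreadingModels.
Variable R : realType.

Definition is_seminorm (V : lmodType R) (p : V -> R) : Prop :=
  (forall u v, p (u + v) <= p u + p v) /\
  (forall a v, p (a *: v) = `|a| * p v).

Definition hamel_basis (V : lmodType R) (e : nat -> V) : Prop :=
  (forall n (a : 'I_n -> R), \sum_(i < n) a i *: e i = 0 ->
     forall i, a i = 0) /\
  (forall v, exists n (a : 'I_n -> R), v = \sum_(i < n) a i *: e i).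

(* An F-subsequence on M is the restriction of [x] to
   [restrict_family F M]; the other values of [x] play no role.  The basis
   vector e_j is [e j.-1]. *)
Definition generates (X : normedModType R) (F : set {fset nat}) (M : set nat)
    (x : {fset nat} -> X) (V : lmodType R) (p : V -> R) (e : nat -> V) : Prop :=
  exists delta : nat -> R,
    [/\ forall n, 0 < delta n,
        delta n @[n --> \oo] --> 0
      & forall k l, (1 <= k <= l)%N ->
        forall s : k.-tuple {fset nat},
          plegma s ->
          (forall j, restrict_family F M (tnth s j)) ->
          (selt M l <= felt (head fset0 s) 1)%N ->
        forall a : 'I_k -> R, (forall j, -1 <= a j <= 1) ->
          `| `|\sum_(j < k) a j *: x (tnth s j)|
             - p (\sum_(j < k) a j *: e j) | <= delta l].

Definition is_spreading_model (X : normedModType R) (xi : cord)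
    (V : lmodType R) (p : V -> R) (e : nat -> V) : Prop :=
  [/\ is_seminorm p, hamel_basis e &
      exists (F : set {fset nat}) (M : set nat) (x : {fset nat} -> X),
        [/\ regular_thin F, has_order F xi,
            M `<=` pos_nat, infinite_set M & generates F M x p e]].

(* [E], with the canonical map [iota], is the completion of the quotient of
   the seminormed space (V, p) by the kernel of p. *)
Definition is_completion (V : lmodType R) (p : V -> R)
    (E : completeNormedModType R) (iota : {linear V -> E}) : Prop :=
  (forall v, `|iota v| = p v) /\ dense (range iota).

Definition contains_isomorphic_copy (Y E : normedModType R) : Prop :=
  exists (T : {linear Y -> E}) (c C : R),
    0 < c /\ forall y, c * `|y| <= `|T y| <= C * `|y|.

End SpreadingModels.

Section SequenceSpaces.
Variable R : realType.
Implicit Types x y : nat -> R.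

Definition ell1_norm x : R := limn [series `|x n|]_n.
Definition sup_norm x : R := sup (range (fun n => `|x n|)).

Definition ell1_pred : {pred nat -> R} := fun x => `[< cvgn [series `|x n|]_n >].
Definition c0_pred : {pred nat -> R} := fun x => `[< x n @[n --> \oo] --> 0 >].
Definition c00_pred : {pred nat -> R} :=
  fun x => `[< \forall n \near \oo, x n = 0 >].

Lemma ell1P x : reflect (cvgn [series `|x n|]_n) (x \in ell1_pred).
Proof. exact: asboolP. Qed.

Lemma c0P x : reflect (x n @[n --> \oo] --> 0) (x \in c0_pred).
Proof. exact: asboolP. Qed.

Lemma c00P x : reflect (\forall n \near \oo, x n = 0) (x \in c00_pred).
Proof. exact: asboolP. Qed.

Lemma ell1_submod_closed : submod_closed ell1_pred.
Proof.
split=> [|a x y /ell1P cx /ell1P cy]; apply/ell1P.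
  rewrite (_ : [series _]_n = cst 0); first exact: is_cvg_cst.
  by apply/funext => n; rewrite /series/= big1// => i _; rewrite normr0.
apply: (@series_le_cvg _ _ (`|a| *: (fun n => `|x n|) + (fun n => `|y n|))) => [n|n|n|].
- exact: normr_ge0.
- by rewrite addr_ge0// mulr_ge0.
- by rewrite (le_trans (ler_normD _ _))// normrM.
- by apply: is_cvg_seriesD => //; exact: is_cvg_seriesZ.
Qed.

Lemma c0_submod_closed : submod_closed c0_pred.
Proof.
split=> [|a x y /c0P cx /c0P cy]; apply/c0P; first exact: cvg_cst.
by rewrite -[0](addr0) -{1}(mulr0 a); apply: cvgD => //; apply: cvgM => //; exact: cvg_cst.
Qed.

Lemma c00_submod_closed : submod_closed c00_pred.
Proof.
split=> [|a x y /c00P cx /c00P cy]; apply/c00P; first exact: nearW.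
by apply: filterS2 cx cy => n xn yn; rewrite !fctE xn yn scaler0 addr0.
Qed.

HB.instance Definition _ :=
  GRing.isSubmodClosed.Build R (nat -> R) ell1_pred ell1_submod_closed.
HB.instance Definition _ :=
  GRing.isSubmodClosed.Build R (nat -> R) c0_pred c0_submod_closed.
HB.instance Definition _ :=
  GRing.isSubmodClosed.Build R (nat -> R) c00_pred c00_submod_closed.

Record ell1 := Ell1 { ell1_val :> nat -> R; _ : ell1_val \in ell1_pred }.
HB.instance Definition _ := [isSub for ell1_val].
HB.instance Definition _ := [Choice of ell1 by <:].
HB.instance Definition _ := [SubChoice_isSubLmodule of ell1 by <:].

Record c0 := C0 { c0_val :> nat -> R; _ : c0_val \in c0_pred }.
HB.instance Definition _ := [isSub for c0_val].
HB.instance Definition _ := [Choice of c0 by <:].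
HB.instance Definition _ := [SubChoice_isSubLmodule of c0 by <:].

Record c00 := C00 { c00_val :> nat -> R; _ : c00_val \in c00_pred }.
HB.instance Definition _ := [isSub for c00_val].
HB.instance Definition _ := [Choice of c00 by <:].
HB.instance Definition _ := [SubChoice_isSubLmodule of c00 by <:].

Lemma ell1_cvg (x : ell1) : cvgn [series `|x n|]_n.
Proof. exact/ell1P/(valP x). Qed.

Lemma c0_cvg (x : c0) : x n @[n --> \oo] --> 0.
Proof. exact/c0P/(valP x). Qed.

Lemma ell1_normD (x y : ell1) : ell1_norm (x + y) <= ell1_norm x + ell1_norm y.
Proof.
rewrite /ell1_norm -lim_seriesD; [|exact: ell1_cvg..].
apply: lim_series_le; first exact: (@ell1_cvg (x + y)).
  by apply: is_cvg_seriesD; exact: ell1_cvg.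
by move=> n; exact: ler_normD.
Qed.

Lemma ell1_normZ (a : R) (x : ell1) : ell1_norm (a *: x) = `|a| * ell1_norm x.
Proof.
rewrite /ell1_norm -[RHS]/(`|a| *: _) -lim_seriesZ; last exact: ell1_cvg.
by congr (limn (series _)); apply/funext => n; exact: normrM.
Qed.

Lemma ell1_norm_eq0 (x : ell1) : ell1_norm x = 0 -> x = 0.
Proof.
move=> x0; apply/val_inj/funext => n /=.
have nd : nondecreasing_seq [series `|x n|]_n.
  by apply: nondecreasing_series => k _ _; exact: normr_ge0.
have := nondecreasing_cvgn_le nd (@ell1_cvg x) n.+1.
rewrite -/(ell1_norm x) x0 /series/= big_nat_recr//= => le0.
apply/normr0_eq0/le_anti; rewrite normr_ge0 andbT.
by apply: le_trans le0; rewrite lerDr sumr_ge0.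
Qed.

HB.instance Definition _ :=
  Lmodule_isNormed.Build R ell1 ell1_normD ell1_normZ ell1_norm_eq0.

Lemma c0_norm_ub (x : c0) n : `|x n| <= sup_norm x.
Proof.
apply: ub_le_sup; last by exists n.
have /cvg_seq_bounded/bounded_fun_has_ubound [M xM] : cvgn (fun n => `|x n|).
  by apply: is_cvg_norm; apply/cvg_ex; exists 0; exact: c0_cvg.
by exists M.
Qed.

Lemma c0_norm_le (x : c0) M : (forall n, `|x n| <= M) -> sup_norm x <= M.
Proof. by move=> xM; apply: ge_sup => [|_ [n _ <-]//]; exists `|x 0|, 0%N. Qed.

Lemma c0_normD (x y : c0) : sup_norm (x + y) <= sup_norm x + sup_norm y.
Proof.
apply: (@c0_norm_le (x + y)) => n.
by rewrite (le_trans (ler_normD _ _))// lerD//; exact: c0_norm_ub.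
Qed.

Lemma c0_normZ (a : R) (x : c0) : sup_norm (a *: x) = `|a| * sup_norm x.
Proof.
apply/le_anti/andP; split.
  by apply: (@c0_norm_le (a *: x)) => n; rewrite normrM ler_wpM2l// c0_norm_ub.
have [->|a0] := eqVneq a 0.
  by rewrite normr0 mul0r (le_trans (normr_ge0 _) (c0_norm_ub (0 *: x) 0)).
rewrite mulrC -ler_pdivlMr ?normr_gt0//; apply: c0_norm_le => n.
rewrite ler_pdivlMr ?normr_gt0// mulrC -normrM.
exact: (c0_norm_ub (a *: x)).
Qed.

Lemma c0_norm_eq0 (x : c0) : sup_norm x = 0 -> x = 0.
Proof.
move=> x0; apply/val_inj/funext => n; apply/normr0_eq0/le_anti.
by rewrite normr_ge0 andbT -x0 c0_norm_ub.
Qed.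

HB.instance Definition _ :=
  Lmodule_isNormed.Build R c0 c0_normD c0_normZ c0_norm_eq0.

Lemma unit_seq_c00 j : (fun n => (n == j)%:R) \in c00_pred.
Proof. by apply/c00P; exists j.+1 => // n /= jn; rewrite gtn_eqF. Qed.

(* The usual basis of l^1, and of c_0: a Hamel basis of c_00, which is then
   equipped with [ell1_norm], respectively with [sup_norm]. *)
Definition usual_basis (j : nat) : c00 := C00 (unit_seq_c00 j).

End SequenceSpaces.

(* Main.v *)
(* The two cases run in parallel, with (op, Y) = (+, l^1) or (max, c_0).  As E
   contains Y and the span of (e_n) is dense in E, a small perturbation of the
   image of the basis of Y gives vectors of the span equivalent to that basis.
   In the span of d + 1 of them there is a nonzero combination with vanishing
   first d coordinates, so there is a block sequence of (e_n) equivalent to the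
   basis of Y, and James' distortion argument improves it to a block sequence
   (u_n) whose tails are almost isometric to the basis of Y.

   Let (x_s) generate (e_n) with s in F, and let G be the family of the sets
   {n} u s with n < min s and s in F; it has order xi + 1.  To v = {n} u s
   assign the combination of a long plegma family of elements of F, obtained by
   shifting s, whose coefficients are those of u_n.  If v_1, ..., v_k is plegma
   then the first elements of v_1, ..., v_k all precede the second element of
   v_1, so the total length of the blocks involved is known before the sets s
   start.  The combined family is thus plegma and starts late enough for the
   combination of the x_s to be close to that of the e_n. *)
Require Import Defs.
From mathcomp Require Import all_boot all_order all_algebra finmap.
From mathcomp Require Import all_classical all_reals all_analysis.
From mathcomp Require Import zify lra.
Set Implicit Arguments.
Unset Strict Implicit.
Unset Printing Implicit Defensive.
Import Order.TTheory GRing.Theory Num.Theory.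
Import numFieldNormedType.Exports.
Local Open Scope classical_set_scope.

(** * Finite sets as increasing lists *)

(** Three obstacles lie behind the outline. First, a shift of a set of [F] need not be in [F]. The
    shifts used here move points down; an initial segment of the result is then in [F], since
    otherwise one more point could be added and spreading would push the whole set back up past the
    original one, against thinness. This needs an enumeration [lam] along which sets of [hat F]
    outside [F] extend by every later point. Second, generation compares a [k]-tuple only with the
    first [k] vectors of [(e_n)], whereas the blocks sit at far positions; invariance under
    spreading is obtained by reading one plegma family of [x_s] twice, with and without zero
    coefficients. Third, the blocks have unbounded coefficients, which multiply the error [delta];
    the sparse set carrying the new family is therefore chosen after the blocks, with gaps long
    enough to hold the shifts and late enough to absorb that factor. The order is exactly [xi + 1]
    because shifting up never lowers a rank, so the part of [hat F] above [n] has the full rank of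
    [hat F]. *)

(* [els s] lists [s] increasingly, so that [felt s k.+1 = nth 0 (els s) k]. *)
Definition els (s : {fset nat}) : seq nat := sort leq s.
Definition fs (l : seq nat) : {fset nat} := [fset x in l]%fset.

Lemma els_sorted s : sorted ltn (els s).
Proof.
by rewrite ltn_sorted_uniq_leq sort_uniq fset_uniq sort_sorted //; exact: leq_total.
Qed.

Lemma mem_els s x : (x \in els s) = (x \in s).
Proof. by rewrite mem_sort. Qed.

Lemma mem_fs l x : (x \in fs l) = (x \in l).
Proof. by rewrite !inE. Qed.

Lemma sorted_ltn_eq (l l' : seq nat) :
  sorted ltn l -> sorted ltn l' -> l =i l' -> l = l'.
Proof. by apply: irr_sorted_eq; [exact: ltn_trans|exact: ltnn]. Qed.

Lemma els_fs l : sorted ltn l -> els (fs l) = l.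
Proof.
move=> sl; apply: sorted_ltn_eq => //; first exact: els_sorted.
by move=> x; rewrite mem_els mem_fs.
Qed.

Lemma fs_els s : fs (els s) = s.
Proof. by apply/fsetP => x; rewrite mem_fs mem_els. Qed.

Lemma fs_nil : fs [::] = fset0.
Proof. by apply/fsetP => x; rewrite mem_fs. Qed.

Lemma size_els s : size (els s) = #|` s|.
Proof. exact: size_sort. Qed.

Lemma card_fs l : sorted ltn l -> #|` fs l| = size l.
Proof. by move=> sl; rewrite -size_els els_fs. Qed.

Lemma feltE s k : felt s k.+1 = nth 0 (els s) k.
Proof. by []. Qed.

Lemma sorted_ltn_cat (l l' : seq nat) :
  sorted ltn (l ++ l') = [&& allrel ltn l l', sorted ltn l & sorted ltn l'].
Proof. by rewrite !(sorted_pairwise ltn_trans) pairwise_cat. Qed.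

Lemma sorted_ltn_cons x (l : seq nat) :
  sorted ltn (x :: l) = all (ltn x) l && sorted ltn l.
Proof. by rewrite !(sorted_pairwise ltn_trans). Qed.

Lemma sorted_ltn_rcons (l : seq nat) x :
  sorted ltn (rcons l x) = all (fun y => y < x) l && sorted ltn l.
Proof.
rewrite -cats1 sorted_ltn_cat/= andbT; congr (_ && _).
by rewrite allrel1r.
Qed.

Lemma initial_segmentP t s :
  initial_segment t s <-> exists l, els s = els t ++ l.
Proof.
split=> [[ts tini]|[l e]].
  exists (els (s `\` t)%fset); apply: sorted_ltn_eq; first exact: els_sorted.
    rewrite sorted_ltn_cat !els_sorted !andbT; apply/allrelP => x y.
    rewrite !mem_els in_fsetD => xt /andP[yt ys]; rewrite /= ltnNge.
    by apply: contra yt => yx; apply: (tini x).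
  move=> x; rewrite mem_cat !mem_els in_fsetD.
  by have := fsubsetP ts x; case: (x \in t) => //= ->.
have ms x : x \in s = (x \in t) || (x \in l).
  by rewrite -[x \in s]mem_els e mem_cat mem_els.
split; first by apply/fsubsetP => x xt; rewrite ms xt.
move=> m n mt; rewrite ms => /orP[//|nl] nm.
have := els_sorted s; rewrite e sorted_ltn_cat => /andP[/allrelP/(_ m n)].
by rewrite mem_els => /(_ mt nl) /=; rewrite ltnNge nm.
Qed.

Lemma initial_segment_fs l l' : sorted ltn (l ++ l') ->
  initial_segment (fs l) (fs (l ++ l')).
Proof.
move=> sl; apply/initial_segmentP; exists l'; rewrite !els_fs//.
by move: sl; rewrite sorted_ltn_cat => /and3P[].
Qed.

Lemma proper_initial_segmentP t s :
  proper_initial_segment t s <-> exists x l, els s = els t ++ x :: l.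
Proof.
split=> [[/initial_segmentP[[|x l] e] ts]|[x [l e]]].
- by case: ts; rewrite -[t]fs_els -[s]fs_els e cats0.
- by exists x, l.
- split; first by apply/initial_segmentP; exists (x :: l).
  by move=> ts; move/(congr1 size): e; rewrite ts size_cat/=; lia.
Qed.

Lemma hat_fsP F l : sorted ltn l ->
  (hat F (fs l) <-> exists2 l', sorted ltn (l ++ l') & F (fs (l ++ l'))).
Proof.
move=> sl; split=> [[s Fs /initial_segmentP[l' e]]|[l' sl' Fl']].
  move: e; rewrite els_fs // => e; exists l'; rewrite -e ?els_sorted //.
  by rewrite fs_els.
by exists (fs (l ++ l')) => //; exact: initial_segment_fs.
Qed.

Lemma hat_prefix F l l' : sorted ltn (l ++ l') ->
  hat F (fs (l ++ l')) -> hat F (fs l).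
Proof.
move=> sl /(hat_fsP _ sl)[l'' sl'' Fl'']; apply/hat_fsP.
  by move: sl; rewrite sorted_ltn_cat => /and3P[].
by exists (l' ++ l''); rewrite catA.
Qed.

Lemma sub_hat F : F `<=` hat F.
Proof. by move=> s Fs; exists s => //; split=> // m n. Qed.

Lemma hat_nil F : F !=set0 -> hat F (fs [::]).
Proof.
by move=> [s Fs]; exists s => //; rewrite fs_nil; split=> //; exact: fsub0set.
Qed.

Lemma thin_hat F l x l' : thin F -> sorted ltn (l ++ x :: l') ->
  F (fs l) -> ~ hat F (fs (l ++ x :: l')).
Proof.
move=> thF sl Fl /(hat_fsP _ sl)[l'' sl'' Fl'']; apply: thF Fl Fl'' _.
apply/proper_initial_segmentP; exists x, (l' ++ l'').
rewrite !els_fs -?catA//; first by move: sl; rewrite sorted_ltn_cat => /and3P[].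
by move: sl''; rewrite -catA.
Qed.

Lemma spreading_fs G l l' : spreading G -> sorted ltn l -> sorted ltn l' ->
  G (fs l) -> size l = size l' -> all (ltn 0) l' ->
  (forall k, k < size l -> nth 0 l k <= nth 0 l' k) -> G (fs l').
Proof.
move=> spG sl sl' Gl ll' /allP l'0 le; apply: (spG (fs l)) => //.
- by move=> x /=; rewrite mem_fs => /l'0.
- by rewrite !card_fs.
- by move=> [//|k]; rewrite card_fs// => /= kl; rewrite !feltE !els_fs// le.
Qed.

(** If every finite subset of an infinite [A] were in [G], the truncations of [A] would converge to
    a point of the closure that is not a finite set. Conversely, by heredity a limit point has all
    its finite subsets in [G], so its support cannot be infinite. *)
Lemma compact_familyP (G : set {fset nat}) : hereditary G ->
  compact_family G <->
  (forall A : set nat, infinite_set A -> exists2 s : {fset nat}, [set` s] `<=` A & ~ G s).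
Proof.
move=> hG; split=> [cG A infA|H].
  apply: contrapT => /forall2NP noG.
  have GA s : [set` s] `<=` A -> G s by move=> sA; have [//|/contrapT] := noG s.
  pose r n := [fset x in iota 0 n | x \in A]%fset.
  pose chi : cantor_space := fun n => n \in A.
  have : (char_fun @` G) chi.
    apply: (@closed_cvg _ _ \oo _ (fun n => char_fun (r n)) (char_fun @` G)).
    - exact: cG.
    - apply: nearW => n; exists (r n) => //; apply: GA => x /=.
      by rewrite !inE => /andP[_ /set_mem].
    - apply/cvg_sup => i U [V] [[W] oW <-] /= Wi WU.
      apply: filterS WU _; exists i.+1 => // n /= ni.
      suff : char_fun (r n) i = chi i by move=> ->.
      by rewrite /char_fun /chi /r !inE mem_iota /= add0n ni.
  case=> s Gs sA; apply: infA; rewrite (_ : A = [set` s]); first exact: finite_fset.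
  apply/seteqP; split => x /=.
    by move=> /mem_set; rewrite -[x \in s]/(char_fun s x) sA.
  by rewrite -[x \in s]/(char_fun s x) sA => /set_mem.
rewrite /compact_family => f cf.
have cyl n : exists2 s, G s & forall i, i < n -> char_fun s i = f i.
  have : nbhs f [set g : cantor_space | forall i, i < n -> g i = f i].
    elim: n => [|n IH]; first by apply: filterS filterT => g _ i.
    have pn : nbhs f (proj n @^-1` [set f n]).
      apply: (@proj_continuous _ (fun=> bool) n f).
      exact: discrete_set1.
    apply: filterS2 IH pn => g IH /= gn i; rewrite ltnS leq_eqVlt => /orP[/eqP->|/IH//].
    exact: gn.
  by move=> /cf[_ [[s Gs <-] sf]]; exists s.
have GA (s : {fset nat}) : [set` s] `<=` [set n | f n] -> G s.
  move=> sf; have [t Gt tf] := cyl (\max_(i <- s) i).+1.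
  apply: hG Gt _; apply/fsubsetP => x xs.
  rewrite -[x \in t]/(char_fun t x) tf; last by rewrite ltnS; apply: leq_bigmax_seq.
  exact: sf.
have [/finite_fsetP[s sE]|/H[s sA []]] := pselect (finite_set [set n | f n]); last exact: GA.
exists s; first by apply: GA; rewrite -sE.
apply/funext => n; rewrite /char_fun; apply/idP/idP => [ns|fn].
  by have : [set n | f n] n by rewrite sE.
by have : [set` s] n by rewrite -sE.
Qed.

(** * The family of order xi + 1 *)

Lemma sorted_shift n l : sorted ltn l -> sorted ltn [seq n + x | x <- l].
Proof.
move=> sl; rewrite sorted_map; apply: sub_sorted sl => x y /=.
by rewrite ltn_add2l.
Qed.

Lemma regular_thin_pos F l : regular_thin F -> sorted ltn l ->
  hat F (fs l) -> all (ltn 0) l.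
Proof.
move=> [posF _ _] sl /(hat_fsP _ sl)[l' sl' /posF Fl']; apply/allP => x xl.
by apply: (Fl' x); rewrite /= mem_fs mem_cat xl.
Qed.

Lemma hat_shift F n l : regular_thin F -> sorted ltn l ->
  hat F (fs l) -> hat F (fs [seq n + x | x <- l]).
Proof.
move=> rtF sl Fl; have /allP l0 := regular_thin_pos rtF sl Fl.
have [_ _ [_ spF _]] := rtF.
apply: (spreading_fs spF sl (sorted_shift n sl) Fl); first by rewrite size_map.
  by apply/allP => _ /mapP[y yl ->] /=; have /= := l0 y yl; lia.
by move=> k kl; rewrite (nth_map 0)// leq_addl.
Qed.

(** A member of [F] shifted beyond [n] stays in [hat F], and any completion to a member of [F] adds
    only larger points. *)
Lemma regular_thin_cofinal F n : regular_thin F -> F !=set0 -> ~ F fset0 ->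
  exists2 l, sorted ltn (n :: l) & F (fs l).
Proof.
move=> rtF [s Fs] F0.
have := hat_shift n.+1 rtF (els_sorted s); rewrite fs_els => /(_ (sub_hat Fs)).
have ss := sorted_shift n.+1 (els_sorted s).
move=> /(hat_fsP _ ss)[l' sl' Fl']; exists ([seq n.+1 + x | x <- els s] ++ l') => //.
case E : (els s) sl' Fl' => [|y l] sl' Fl'.
  by exfalso; apply: F0; rewrite -fs_nil -E fs_els.
by rewrite sorted_ltn_cons sl' andbT; move: sl'; rewrite /= => sl';
  rewrite leq_addr/=; have := order_path_min ltn_trans sl';
  apply: sub_all => z /=; lia.
Qed.

Definition succ_family (F : set {fset nat}) : set {fset nat} :=
  [set v | exists n l, [/\ 0 < n, sorted ltn (n :: l), F (fs l) & v = fs (n :: l)]].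

Lemma succ_fsP F l : sorted ltn l ->
  succ_family F (fs l) <-> exists n l', [/\ l = n :: l', 0 < n & F (fs l')].
Proof.
move=> sl; split=> [[n [l' [n0 snl Fl' /(congr1 els)]]]|[n [l' [le n0 Fl']]]].
  by rewrite !els_fs// => ->; exists n, l'.
by exists n, l'; rewrite -le.
Qed.

Section SuccFamily.
Variable F : set {fset nat}.
Hypotheses (rtF : regular_thin F) (Fn0 : F !=set0) (F0 : ~ F fset0).
Let G := succ_family F.

(** The point to check is that a singleton [n] extends to a member of the family: this takes a set
    of [F] lying above [n]. When [l'] is nonempty, its completion in [F] is automatically above
    [n]. *)
Lemma hat_succ_fsP l : sorted ltn l ->
  hat G (fs l) <->
  l = [::] \/ exists n l', [/\ l = n :: l', 0 < n & hat F (fs l')].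
Proof.
move=> sl; split.
  move=> /(hat_fsP _ sl)[l' sl' /(succ_fsP _ sl')[n [l'' [e n0 Fl'']]]].
  case: l sl sl' e => [|m l] sl sl' /=; first by left.
  move=> [mn e]; right; exists m, l; split; rewrite ?mn//.
  have s2 : sorted ltn (l ++ l') by move: sl'; rewrite cat_cons sorted_ltn_cons => /andP[].
  by apply: (hat_prefix s2); rewrite e; exact: sub_hat.
case=> [->|[n [l' [le n0]]]].
  have [l' sl' Fl'] := regular_thin_cofinal 1 rtF Fn0 F0.
  apply/hat_fsP => //; exists (1 :: l') => //.
  by apply/succ_fsP => //; exists 1, l'.
rewrite le in sl *; have := sl; rewrite sorted_ltn_cons => /andP[nl' sl'].
move=> /(hat_fsP _ sl')[l'' s2 Fl'']; apply/hat_fsP => //.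
case: l' sl nl' sl' s2 Fl'' {le} => [|x l'] sl nl' sl' s2 Fl''.
  have [k sk Fk] := regular_thin_cofinal n rtF Fn0 F0.
  by exists k => //; apply/succ_fsP => //; exists n, k.
have s3 : sorted ltn ((n :: x :: l') ++ l'').
  by move: nl' s2; rewrite /= => /andP[-> _] ->.
by exists l'' => //; apply/succ_fsP => //; exists n, ((x :: l') ++ l'').
Qed.

Lemma regular_thin_succ : regular_thin G.
Proof.
have [posF thF [hF spF cF]] := rtF.
have hG : hereditary (hat G).
  move=> s t; rewrite -[s]fs_els -[t]fs_els.
  have ss := els_sorted s; have st := els_sorted t.
  move: (els s) (els t) ss st => {s t} s t ss st.
  move=> /(hat_succ_fsP ss) H /fsubsetP ts; apply/hat_succ_fsP => //.
  case: t st ts => [|m t] st ts; [by left|right; exists m, t].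
  have ts' x : x \in m :: t -> x \in s by move=> xt; rewrite -mem_fs; apply: ts; rewrite mem_fs.
  case: H => [s0|[n [l [se n0 Fl]]]]; first by have := ts' m (mem_head _ _); rewrite s0.
  (* Every point of [t] exceeds [m], hence [n], so [t] lies in [l] whether or not [m] equals [n]. *)
  have nm : n <= m.
    have := ts' m (mem_head _ _); rewrite se inE => /orP[/eqP->//|ml].
    by move: ss; rewrite se sorted_ltn_cons => /andP[/allP/(_ _ ml)/ltnW].
  split => //; first exact: leq_trans nm.
  apply: hF Fl _; apply/fsubsetP => x; rewrite !mem_fs => xt.
  have := ts' x; rewrite !inE xt orbT => /(_ isT); rewrite se inE => /orP[/eqP xn|//].
  by move: st; rewrite sorted_ltn_cons => /andP[/allP/(_ _ xt)/=]; rewrite xn ltnNge nm.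
split=> //; last split=> //.
- move=> _ [n [l [n0 sl Fl ->]]] x /=; rewrite mem_fs inE => /orP[/eqP->//|xl].
  by apply: (posF _ Fl); rewrite /= mem_fs.
- move=> _ _ [n [l [_ sl Fl ->]]] [m [l' [_ sl' Fl' ->]]].
  move=> /proper_initial_segmentP[x [r]]; rewrite !els_fs//= => -[_ e].
  apply: (thF _ _ Fl Fl'); apply/proper_initial_segmentP; exists x, r.
  by rewrite !els_fs ?(path_sorted sl)// (path_sorted sl').
- move=> s t; rewrite -[s]fs_els -[t]fs_els.
  have ss := els_sorted s; have st := els_sorted t.
  move: (els s) (els t) ss st => {s t} s t ss st.
  move=> /(hat_succ_fsP ss) H tpos; rewrite !card_fs// => ste le.
  apply/hat_succ_fsP => //.
  case: t st ste le tpos => [|m t] st ste le tpos; [by left|right; exists m, t].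
  have m0 : 0 < m by apply: (tpos m); rewrite /= mem_fs mem_head.
  split => //.
  case: H => [s0|[n [l [se n0 Fl]]]]; first by move: ste; rewrite s0.
  rewrite {}se in ss ste le.
  apply: (spreading_fs spF (path_sorted ss) (path_sorted st) Fl).
  + by case: ste.
  + by apply: sub_all (order_path_min ltn_trans st) => x /=; exact: leq_ltn_trans.
  + move=> k kl; have /= := le k.+2; rewrite !feltE !els_fs//=; apply.
    by rewrite ltnS.
- apply/compact_familyP => // A infA.
  have [a0 Aa0] := infinite_setN0 infA.
  have exA : exists a, a \in A by exists a0; exact/mem_set.
  (* The least point of [A] is kept as first element; prefixing it to a finite set outside [hat F]
     gives a set outside [hat G]. *)
  have [a /set_mem Aa amin] := ex_minnP exA.
  have infA' : infinite_set (A `\ a) by apply: infinite_setD => //; exact: finite_set1.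
  have [s sA Fs] := (compact_familyP hF).1 cF _ infA'.
  have sas : sorted ltn (a :: els s).
    rewrite sorted_ltn_cons els_sorted andbT; apply/allP => x /=.
    rewrite mem_els => xs; have [Ax /eqP xa] := sA x xs.
    by rewrite ltn_neqAle eq_sym xa amin//; exact/mem_set.
  exists (fs (a :: els s)).
    move=> x /=; rewrite mem_fs inE mem_els => /orP[/eqP->//|xs].
    by have [] := sA x xs.
  move=> /(hat_succ_fsP sas)[//|[n [l [[_ <-] _]]]].
  by rewrite fs_els.
Qed.

(** * Ranks in the enlarged tree *)

Section Rank.
Variable rk : {fset nat} -> cord.
Hypothesis rkF : is_rank (hat F) rk.

Lemma rank_lt l x l' : sorted ltn (l ++ x :: l') -> hat F (fs (l ++ x :: l')) ->
  ole (osucc (rk (fs (l ++ x :: l')))) (rk (fs l)).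
Proof.
move=> sl Fl; have [ub _] := rkF (hat_prefix sl Fl); apply: ub.
exists (fs (l ++ x :: l')) => //; split=> //; apply/proper_initial_segmentP.
exists x, l'; rewrite !els_fs//.
by move: sl; rewrite sorted_ltn_cat => /and3P[].
Qed.

Lemma rank_le l c : sorted ltn l -> hat F (fs l) ->
  (forall x l', sorted ltn (l ++ x :: l') -> hat F (fs (l ++ x :: l')) ->
     ole (osucc (rk (fs (l ++ x :: l')))) c) -> ole (rk (fs l)) c.
Proof.
move=> sl Fl H; have [_ least] := rkF Fl.
apply: least => _ [t [Ft /proper_initial_segmentP[x [l' e]]] <-].
rewrite els_fs// in e.
by rewrite -[t]fs_els e; apply: H; rewrite -e ?els_sorted// fs_els.
Qed.

(* The shift is strictly monotone for proper initial segments, and maps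
   [hat F] to its members above [n]. *)
Lemma rank_shift n l : sorted ltn l -> hat F (fs l) ->
  ole (rk (fs l)) (rk (fs [seq n + x | x <- l])).
Proof.
(* The induction is structural on a notation [a] bounding the rank, since the rank of an extension
   is only bounded by, not equal to, a term listed in [a]. *)
move=> sl Fl; have := ole_refl (rk (fs l)); move: {2}(rk (fs l)) => a.
move: a l sl Fl; fix IH 1 => -[f] l sl Fl la.
apply: rank_le => // x l' sl' Fl'.
have : ole (osucc (rk (fs (l ++ x :: l')))) (Olsup f).
  by apply: ole_trans la; exact: rank_lt.
move=> /(_ 0)[m]; case: (f m) => [a|//] xa.
have {xa} := IH a _ sl' Fl' xa.
set t := [seq _ | _ <- _] => lt.
have st : sorted ltn t by apply: sorted_shift.
have Ft : hat F (fs t) by apply: hat_shift.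
have := @rank_lt [seq n + x | x <- l] (n + x) [seq n + x | x <- l'].
rewrite -map_cons -map_cat => /(_ st Ft) tl.
by apply: ole_trans tl => _ /=; exists 0.
Qed.

Definition succ_rank (u : {fset nat}) : cord :=
  if els u is n :: l then rk (fs l) else osucc (rk (fs [::])).

Lemma succ_rank_fs n l : sorted ltn (n :: l) -> succ_rank (fs (n :: l)) = rk (fs l).
Proof. by move=> sl; rewrite /succ_rank els_fs. Qed.

(** The delicate case is a singleton [n]: its extensions only see the sets of [hat F] above [n],
    while [rk] of the empty set is a supremum over all of [hat F]. [rank_shift] moves any set above
    [n] without loss of rank. *)
Lemma is_rank_succ : is_rank (hat G) succ_rank.
Proof.
move=> u; rewrite -[u]fs_els; have su := els_sorted u.
have hat0 := hat_nil Fn0.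
move: (els u) su => {u} u su Gu.
have oS a b : ole a b -> ole (osucc a) (osucc b) by move=> ab n /=; exists 0.
split.
  move=> _ [t [Gt /proper_initial_segmentP[x [l e]]] <-].
  rewrite els_fs// in e; move: Gt; rewrite -[t]fs_els.
  have st := els_sorted t; move: (els t) st e => {t} t st e /(hat_succ_fsP st).
  move=> [t0|[n [l' [t0 n0 Fl']]]]; first by move: e; rewrite t0; case: u {su Gu}.
  rewrite {}t0 in st e *; rewrite succ_rank_fs//.
  have sl' := path_sorted st.
  case: u su Gu e => [|y u] su Gu e.
    rewrite /succ_rank /= els_fs//; apply: (oS).
    case: l' Fl' {st e} sl' => [|z l'] Fl' sl'; first exact: ole_refl.
    apply: ole_trans (ole_osucc (ole_refl _)) _.
    exact: (@rank_lt [::]).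
  case: e => _ e; rewrite succ_rank_fs// e; apply: rank_lt; by rewrite -e.
move=> c cub.
have {}cub x l : sorted ltn (u ++ x :: l) -> hat G (fs (u ++ x :: l)) ->
    ole (osucc (succ_rank (fs (u ++ x :: l)))) c.
  move=> sl Gl; apply: cub; exists (fs (u ++ x :: l)) => //; split=> //.
  by apply/proper_initial_segmentP; exists x, l; rewrite !els_fs.
case: u su Gu cub => [|n u] su Gu cub.
  rewrite {1}/succ_rank els_fs//.
  have := cub 1 [::] isT; rewrite succ_rank_fs//; apply.
  by apply/hat_succ_fsP => //; right; exists 1, [::].
have [//|[_ [_ [[<- <-] n0 Fu]]]] := (hat_succ_fsP su).1 Gu.
rewrite succ_rank_fs//.
have {}cub x l : sorted ltn (n :: u ++ x :: l) -> hat F (fs (u ++ x :: l)) ->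
    ole (osucc (rk (fs (u ++ x :: l)))) c.
  move=> sl Fl; rewrite -(succ_rank_fs sl); apply: (cub) => //.
  by apply/hat_succ_fsP => //; right; exists n, (u ++ x :: l).
apply: rank_le => //; first exact: path_sorted su.
move=> x l sl Fl; case: u su Gu cub Fu sl Fl => [|y u] su Gu cub Fu sl Fl; last first.
  by apply: cub => //; case/andP: su => /= ny _; rewrite ny.
apply: (@ole_trans _ (osucc (rk (fs [seq n.+1 + z | z <- x :: l])))).
  by apply: (oS); apply: rank_shift.
apply: (cub _ _ _ (hat_shift n.+1 rtF sl Fl)).
by rewrite sorted_ltn_cons (@sorted_shift n.+1 (x :: l))// andbT; apply/allP => z /= ;
  rewrite -map_cons => /mapP[w _ ->]; lia.
Qed.

End Rank.

Lemma has_order_succ xi : has_order F xi -> has_order G (osucc xi).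
Proof.
rewrite /has_order -fs_nil => -[_ [rk [rkF [le1 le2]]]].
split; first by apply/(@hat_succ_fsP [::]) => //; left.
exists (succ_rank rk); split; first exact: is_rank_succ.
by rewrite /succ_rank (@els_fs [::])//; split=> n /=; exists 0.
Qed.

End SuccFamily.

(** By thinness, a family containing the empty set has only the root in its tree, hence order
    zero. *)
Lemma order_pos F xi : thin F -> has_order F xi -> ole (osucc ozero) xi ->
  F !=set0 /\ ~ F fset0.
Proof.
move=> thF [[s Fs s0] [rk [rkF [le1 le2]]]] xi1; split; first by exists s.
move=> F0; have [_ rk0] := rkF fset0 (ex_intro2 _ _ s Fs s0).
have {}rk0 : ole (rk fset0) ozero.
  apply: rk0 => _ [t [[t' Ft' /initial_segmentP[l e]] /proper_initial_segmentP[x [l' e']]] <-].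
  case: (thF _ _ F0 Ft'); apply/proper_initial_segmentP; exists x, (l' ++ l).
  by rewrite e e' -catA.
by have /(_ 0)[] := ole_trans xi1 (ole_trans le2 rk0).
Qed.

(** * Large initial segments along a sparse subset *)

Lemma homo_ltn_geq (f : nat -> nat) n : {homo f : i j / i < j} -> n <= f n.
Proof. by move=> fh; elim: n => // n IH; apply: leq_ltn_trans IH (fh _ _ _). Qed.

Lemma homo_ltn_leq (f : nat -> nat) : {homo f : i j / i < j} -> {homo f : i j / i <= j}.
Proof.
by move=> fh i j; rewrite leq_eqVlt => /orP[/eqP->//|/fh/ltnW].
Qed.

Lemma homo_ltn_inj (f : nat -> nat) : {homo f : i j / i < j} -> injective f.
Proof.
by move=> fh i j fij; case: (ltngtP i j) => // /fh; rewrite fij ltnn.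
Qed.

Lemma infinite_range_homo (f : nat -> nat) :
  {homo f : i j / i < j} -> infinite_set (range f).
Proof.
move=> fh /finite_fsetP[X fX].
have : [set` X] (f (\max_(x <- X) x).+1) by rewrite -fX; eexists.
move=> /= fm; have : f (\max_(x <- X) x).+1 <= \max_(x <- X) x.
  exact: leq_bigmax_seq.
by rewrite leqNgt (homo_ltn_geq _ fh).
Qed.

Lemma infinite_set_gt (M : set nat) N : infinite_set M -> exists2 y, M y & N < y.
Proof.
move=> infM; apply: contrapT => H; apply: infM.
apply: sub_finite_set (finite_II N.+1) => y My /=; rewrite ltnS leqNgt.
by apply/negP => Ny; apply: H; exists y.
Qed.

Section GoodSubset.
Variable F : set {fset nat}.
Hypotheses (rtF : regular_thin F) (Fn0 : F !=set0).

(** A completion of [l] in [F] has a next point [b]; spreading replaces it by any larger one. *)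
Lemma hat_extend l : sorted ltn l -> hat F (fs l) -> ~ F (fs l) ->
  exists b, forall y, b <= y -> hat F (fs (rcons l y)).
Proof.
move=> sl /(hat_fsP _ sl)[[|b l'] sl' Fl'] Fl; first by rewrite cats0 in Fl'.
exists b => y bylt; have [_ _ [_ spF _]] := rtF.
rewrite -cat_rcons in sl' Fl'.
have sb : sorted ltn (rcons l b) by move: sl'; rewrite sorted_ltn_cat => /and3P[].
have Fb : hat F (fs (rcons l b)) by apply: (hat_prefix sl'); exact: sub_hat.
have /allP pos := regular_thin_pos rtF sb Fb.
apply: (spreading_fs spF sb _ Fb).
- move: sb; rewrite !sorted_ltn_rcons => /andP[lb ->]; rewrite andbT.
  by apply: sub_all lb => x xb; exact: leq_trans bylt.
- by rewrite !size_rcons.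
- apply/allP => x; rewrite mem_rcons inE => /orP[/eqP->|xl].
    by apply: leq_trans bylt; apply: pos; rewrite mem_rcons mem_head.
  by apply: pos; rewrite mem_rcons inE xl orbT.
- by move=> k _; rewrite !nth_rcons; case: ifP => // _; case: ifP.
Qed.

Lemma hat_extend_bounded N : exists B, forall l y, sorted ltn l ->
  all (fun x => x <= N) l -> hat F (fs l) -> ~ F (fs l) -> B <= y ->
  hat F (fs (rcons l y)).
Proof.
have : forall s : {fset nat}, exists b, hat F s -> ~ F s ->
    forall y, b <= y -> hat F (fs (rcons (els s) y)).
  move=> s; have [[h f]|H] := pselect (hat F s /\ ~ F s).
    have := hat_extend (els_sorted s); rewrite fs_els => /(_ h f)[b Hb].
    by exists b.
  by exists 0 => h f; case: H.
move=> /choice[b bP].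
exists (\max_(s <- fpowerset (fs (iota 0 N.+1))) b s) => l y sl lN Fl nFl By.
have := bP _ Fl nFl y; rewrite els_fs //; apply; apply: leq_trans By.
apply: leq_bigmax_seq => //; rewrite fpowersetE; apply/fsubsetP => x.
by rewrite !mem_fs mem_iota => /(allP lN)/=; rewrite add0n ltnS.
Qed.

(* Along an arbitrary infinite set, an element of [hat F] which is not in [F]
   may have no extension in [hat F]: its extensions are only guaranteed to stay
   in [hat F] when the new point is large. *)
Definition good_enum (lam : nat -> nat) :=
  [/\ {homo lam : i j / i < j}, forall n, 0 < lam n &
    forall l j, sorted ltn (rcons l j) -> hat F (fs (map lam l)) ->
      ~ F (fs (map lam l)) -> hat F (fs (map lam (rcons l j)))].

Lemma good_enum_exists M : M `<=` pos_nat -> infinite_set M ->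
  exists2 lam, good_enum lam & forall n, M (lam n).
Proof.
move=> Mpos infM.
have : forall N, exists y, [/\ M y, N < y & forall l, sorted ltn l ->
    all (fun x => x <= N) l -> hat F (fs l) -> ~ F (fs l) -> hat F (fs (rcons l y))].
  move=> N; have [B HB] := hat_extend_bounded N.
  have [y My Ny] := infinite_set_gt (maxn N B) infM.
  exists y; split => //; first by apply: leq_ltn_trans Ny; exact: leq_maxl.
  move=> l sl lN Fl nFl; apply: HB => //; apply: leq_trans (ltnW Ny).
  exact: leq_maxr.
move=> /choice[nx nxP]; pose lam n := iter n nx (nx 0).
have Mlam n : M (lam n) by case: n => [|n]; [case: (nxP 0)|case: (nxP (lam n))].
have lamh : {homo lam : i j / i < j}.
  by apply: homo_ltn => [|n]; [exact: ltn_trans|case: (nxP (lam n))].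
exists lam => //; split=> // [n|l j]; first exact: Mpos.
rewrite sorted_ltn_rcons => /andP[lj sl] Fl nFl; rewrite map_rcons.
have sl' : sorted ltn (map lam l).
  by rewrite sorted_map; apply: sub_sorted sl => x y /=; exact: lamh.
case: j lj => [|j] lj.
  case: (nxP 0) => _ _; apply => //.
  by case: l lj {sl Fl nFl sl'}.
case: (nxP (lam j)) => _ _; apply => //; apply/allP => _ /mapP[x xl ->].
by apply: homo_ltn_leq => //; move/allP: lj => /(_ x xl).
Qed.

Variable lam : nat -> nat.
Hypothesis lamP : good_enum lam.

Lemma sorted_map_enum l : sorted ltn l -> sorted ltn (map lam l).
Proof.
have [lamh _ _] := lamP.
by move=> sl; rewrite sorted_map; apply: sub_sorted sl => x y /=; exact: lamh.
Qed.

(** Otherwise all initial segments along [lam \o f] stay in [hat F], so by heredity an infinite set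
    has all its finite subsets there, against compactness. *)
Lemma cut_infinite f : {homo f : i j / i < j} ->
  exists r, F (fs (map lam (mkseq f r))).
Proof.
move=> fh; apply: contrapT => /forallNP H.
have [lamh _ lamP3] := lamP; have [_ _ [hF _ cF]] := rtF.
have sm r : sorted ltn (mkseq f r).
  by rewrite sorted_map; apply: sub_sorted (iota_ltn_sorted _ _) => x y; exact: fh.
have Hr r : hat F (fs (map lam (mkseq f r))).
  elim: r => [|r IH]; first exact: (hat_nil Fn0).
  by rewrite mkseqS; apply: lamP3 => //; rewrite -mkseqS.
have gh : {homo lam \o f : i j / i < j} by move=> i j /fh/lamh.
have [s sA] := (compact_familyP hF).1 cF _ (infinite_range_homo gh); apply.
have [N sN] : exists N, forall x, x \in s -> x < N.
  by exists (\max_(i <- s) i).+1 => x xs; rewrite ltnS; exact: leq_bigmax_seq.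
apply: hF (Hr N) _; apply/fsubsetP => x xs.
have [i _ ix] := sA _ xs; rewrite mem_fs -ix; apply: map_f; apply: map_f.
rewrite mem_iota add0n; apply: leq_ltn_trans (homo_ltn_geq i gh) _.
by rewrite ix; exact: sN.
Qed.

(** If no initial segment were in [F], the whole image of [js] would be in [hat F] but not in [F],
    and could be extended by a far point [lam j]. Spreading it up onto [l] followed by [lam j] would
    put a proper extension of [l] in [hat F], against thinness. *)
Lemma cut_finite l js : sorted ltn l -> F (fs l) -> sorted ltn js ->
  size js = size l -> (forall k, k < size l -> lam (nth 0 js k) <= nth 0 l k) ->
  exists r, F (fs (map lam (take r js))).
Proof.
move=> sl Fl sj jl le; apply: contrapT => /forallNP H.
have [lamh lam0 lamP3] := lamP; have [_ thF [_ spF _]] := rtF.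
have Hr r : hat F (fs (map lam (take r js))).
  elim: r => [|r IH]; first by rewrite take0; exact: (hat_nil Fn0).
  have [rj|jr] := ltnP r (size js); last first.
    by have := IH; rewrite !take_oversize// (leq_trans jr).
  by rewrite (take_nth 0)//; apply: lamP3 => //; rewrite -take_nth//; exact: take_sorted.
have Hjs := Hr (size js); have nHjs := H (size js).
rewrite take_size in Hjs nHjs.
pose j := (\max_(i <- js) i + \max_(i <- l) i).+1.
have sjj : sorted ltn (rcons js j).
  rewrite sorted_ltn_rcons sj andbT; apply/allP => x xj; rewrite ltnS.
  by apply: leq_trans (leq_addr _ _); apply: leq_bigmax_seq.
have slj : sorted ltn (rcons l (lam j)).
  rewrite sorted_ltn_rcons sl andbT; apply/allP => x xl.
  apply: leq_trans (homo_ltn_geq j lamh); rewrite ltnS.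
  by apply: leq_trans (leq_addl _ _); apply: leq_bigmax_seq.
have Hj := lamP3 _ _ sjj Hjs nHjs.
have : hat F (fs (rcons l (lam j))).
  apply: (spreading_fs spF (sorted_map_enum sjj) slj Hj).
  - by rewrite size_map !size_rcons jl.
  - apply/allP => x; rewrite mem_rcons inE => /orP[/eqP->|xl]; first exact: lam0.
    exact: (allP (regular_thin_pos rtF sl (sub_hat Fl))).
  - move=> k _; rewrite map_rcons !nth_rcons size_map jl.
    by case: ltnP => // kl; rewrite (nth_map 0) ?jl// le.
by rewrite -cats1; apply: thin_hat => //; rewrite cats1.
Qed.

End GoodSubset.

Lemma selt_count_lt (M : set nat) m m' : m < m' -> M m' ->
  \sum_(1 <= j < m.+1) (j \in M : nat) < \sum_(1 <= j < m'.+1) (j \in M : nat).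
Proof.
move=> mm' Mm'; rewrite (@big_cat_nat _ _ _ m'.-1.+1 1 m'.+1)//=; last by lia.
rewrite prednK; last by lia.
rewrite big_nat1 (mem_set Mm') addn1 ltnS.
rewrite (@big_cat_nat _ _ _ m.+1 1 m')//=; exact: leq_addr.
Qed.

Section Selt.
Variables (lam : nat -> nat).
Hypotheses (lamh : {homo lam : i j / i < j}) (lam0 : forall n, 0 < lam n).

Lemma selt_count_ge (M : set nat) n : (forall k, M (lam k)) ->
  n < \sum_(1 <= j < (lam n).+1) (j \in M : nat).
Proof.
move=> Mlam; elim: n => [|n IH].
  have := @selt_count_lt M 0 (lam 0) (lam0 0) (Mlam 0).
  by rewrite big_geq.
by apply: leq_ltn_trans IH _; apply: selt_count_lt => //; exact: lamh.
Qed.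

Lemma selt_le (M : set nat) l n : (forall k, M (lam k)) -> l <= n.+1 ->
  selt M l <= lam n.
Proof.
move=> Mlam ln; rewrite /selt; case: xgetP => // m _ [Mm cm].
rewrite leqNgt; apply/negP => /selt_count_lt/(_ Mm); rewrite cm.
by have := selt_count_ge n Mlam; lia.
Qed.

Lemma selt_range n : selt (range lam) n.+1 = lam n.
Proof.
have ch k : \sum_(1 <= j < (lam k).+1) (j \in range lam : nat) = k.+1.
  elim: k => [|k IH].
    rewrite (@big_cat_nat _ _ _ (lam 0))//= big_nat1 mem_set; last by exists 0.
    rewrite big1_seq// => j /=; rewrite mem_index_iota => /andP[_ j0].
    case: (boolP (j \in _)) => // /set_mem[i _ ij].
    by move: j0; rewrite -ij ltnNge (homo_ltn_leq lamh).
  rewrite (@big_cat_nat _ _ _ (lam k).+1)//= ?IH; last by rewrite ltnS homo_ltn_leq.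
  rewrite (@big_cat_nat _ _ _ (lam k.+1) (lam k).+1)//= ?lamh//.
  rewrite big_nat1 mem_set; last by exists k.+1.
  rewrite big1_seq ?addn1// => j /=; rewrite mem_index_iota => /andP[kj jk].
  case: (boolP (j \in _)) => // /set_mem[i _ ij].
  have ki : k < i by rewrite ltnNge; apply/negP => /(homo_ltn_leq lamh); lia.
  have ik : i < k.+1 by rewrite ltnNge; apply/negP => /(homo_ltn_leq lamh); lia.
  by lia.
rewrite /selt; case: xgetP => [m _ [[k _ <-] e]|/(_ (lam n)) []].
  by move: e; rewrite ch => -[->].
by split=> //; exists n.
Qed.

End Selt.

(** * Norms on blocks of coefficients *)

Local Open Scope ring_scope.

Section BlockNorm.
Variable R : realType.

(* The properties of [op] shared by [+] and [max] on nonnegative reals that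
   make the usual bases of l^1 and c_0 isometric to their normalized blocks. *)
Record norm_op (op : R -> R -> R) : Prop := NormOp {
  norm_op0l : forall x, 0 <= x -> op 0 x = x;
  norm_op0r : forall x, 0 <= x -> op x 0 = x;
  norm_opA : forall x y z, 0 <= x -> 0 <= y -> 0 <= z ->
    op x (op y z) = op (op x y) z;
  norm_opM : forall c x y, 0 <= c -> c * op x y = op (c * x) (c * y);
  norm_op_gel : forall x y, 0 <= x -> 0 <= y -> x <= op x y;
  norm_op_ger : forall x y, 0 <= x -> 0 <= y -> y <= op x y;
  norm_op_leD : forall x y, 0 <= x -> 0 <= y -> op x y <= x + y }.

Lemma norm_op_add : norm_op +%R.
Proof.
split=> *; rewrite ?add0r ?addr0 ?addrA ?mulrDr ?lerDl ?lerDr//.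
Qed.

Lemma norm_op_max : norm_op Num.max.
Proof.
split=> [x x0|x x0|x y z _ _ _|c x y c0|x y _ _|x y _ _|x y x0 y0].
- exact/max_idPr.
- exact/max_idPl.
- exact: maxA.
- exact: maxr_pMr.
- by rewrite le_max lexx.
- by rewrite le_max lexx orbT.
- by rewrite ge_max lerDl lerDr x0 y0.
Qed.

Variable op : R -> R -> R.

(** The l^1 norm (for [+%R]) or the sup norm (for [Num.max], by the absolute values) of the
    coefficients with index in the half-open range from [n] to [m]. *)
Definition bnorm (n m : nat) (a : nat -> R) : R :=
  iteri (m - n) (fun i r => op r `|a (n + i)%N|) 0.

Lemma bnormnn n a : bnorm n n a = 0.
Proof. by rewrite /bnorm subnn. Qed.

Lemma bnormS n m a : (n <= m)%N -> bnorm n m.+1 a = op (bnorm n m a) `|a m|.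
Proof. by move=> nm; rewrite /bnorm subSn//= subnKC. Qed.

Lemma eq_bnorm n m a b : (forall i, (n <= i < m)%N -> a i = b i) ->
  bnorm n m a = bnorm n m b.
Proof.
have [nm|/ltnW mn] := leqP n m; last by rewrite /bnorm (eqP mn).
elim: m nm => [|m IH]; first by rewrite leqn0 => /eqP->; rewrite !bnormnn.
rewrite leq_eqVlt => /orP[/eqP->|nm ab]; first by rewrite !bnormnn.
rewrite !bnormS//; congr op; last by rewrite ab ?leqnn ?andbT.
by apply: IH => // i /andP[ni im]; rewrite ab// ni ltnW.
Qed.

Hypothesis opP : norm_op op.

Lemma norm_op_ge0 x y : 0 <= x -> 0 <= y -> 0 <= op x y.
Proof. by move=> x0 y0; exact: le_trans x0 (norm_op_gel opP x0 y0). Qed.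

Lemma bnorm_ge0 n m a : 0 <= bnorm n m a.
Proof. by rewrite /bnorm; elim: (m - n)%N => //= k IH; exact: norm_op_ge0. Qed.
Hint Resolve bnorm_ge0 : core.

Lemma bnorm1 n a : bnorm n n.+1 a = `|a n|.
Proof. by rewrite bnormS// bnormnn norm_op0l. Qed.

Lemma bnorm_cat k n m a : (n <= k <= m)%N ->
  bnorm n m a = op (bnorm n k a) (bnorm k m a).
Proof.
move=> /andP[nk km]; elim: m km => [|m IH].
  rewrite leqn0 => /eqP k0; move: nk; rewrite k0 leqn0 => /eqP->.
  by rewrite bnormnn norm_op0l.
rewrite leq_eqVlt => /orP[/eqP<-|km]; first by rewrite bnormnn norm_op0r.
by rewrite !bnormS ?(leq_trans nk)// IH// norm_opA.
Qed.

Lemma bnormZ n m c a : bnorm n m (fun i => c * a i) = `|c| * bnorm n m a.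
Proof.
rewrite /bnorm; elim: (m - n)%N => [|k IH] /=; first by rewrite mulr0.
by rewrite IH normrM norm_opM.
Qed.

Lemma bnorm0 n m a : (forall i, (n <= i < m)%N -> a i = 0) -> bnorm n m a = 0.
Proof.
move=> a0; rewrite (@eq_bnorm _ _ _ (fun i => 0 * a i)) => [|i /a0->].
  by rewrite bnormZ normr0 mul0r.
by rewrite mul0r.
Qed.

Lemma bnorm_ub n m a i : (n <= i < m)%N -> `|a i| <= bnorm n m a.
Proof.
move=> /andP[ni im]; rewrite (@bnorm_cat i.+1); last by rewrite im leqW.
rewrite bnormS//.
apply: le_trans (norm_op_gel opP _ _) => //; last exact: norm_op_ge0.
exact: norm_op_ger.
Qed.

Lemma bnorm_le_sum n m a : bnorm n m a <= \sum_(n <= i < m) `|a i|.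
Proof.
have [nm|/ltnW mn] := leqP n m; last by rewrite /bnorm (eqP mn) big_geq.
elim: m nm => [|m IH]; first by rewrite leqn0 => /eqP->; rewrite bnormnn big_geq.
rewrite leq_eqVlt => /orP[/eqP->|nm]; first by rewrite bnormnn big_geq.
rewrite bnormS// big_nat_recr//=; apply: le_trans (norm_op_leD opP _ _) _ => //.
by rewrite lerD2r IH.
Qed.

Lemma bnorm_restrict n k m l a : (n <= k <= m)%N -> (m <= l)%N ->
  bnorm n l (fun i => if (k <= i < m)%N then a i else 0) = bnorm k m a.
Proof.
move=> /andP[nk km] ml; rewrite (@bnorm_cat k) ?nk ?(leq_trans km)//.
rewrite bnorm0 => [|i /andP[_ ik]]; last by rewrite leqNgt ik.
rewrite norm_op0l// (@bnorm_cat m) ?km// (@bnorm0 m) => [|i /andP[mi _]].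
  by rewrite norm_op0r//; apply: eq_bnorm => i ->.
by rewrite ltnNge mi andbF.
Qed.

Lemma sum_restrict (V : lmodType R) (v : nat -> V) n k m l a : (n <= k <= m)%N -> (m <= l)%N ->
  \sum_(n <= i < l) (if (k <= i < m)%N then a i else 0) *: v i =
  \sum_(k <= i < m) a i *: v i.
Proof.
move=> /andP[nk km] ml; rewrite (@big_cat_nat _ _ _ k) ?(leq_trans km)//=.
rewrite big1_seq ?add0r => [|i /=]; last first.
  by rewrite mem_index_iota => /andP[_ ik]; rewrite leqNgt ik scale0r.
rewrite (@big_cat_nat _ _ _ m)//= [X in _ + X]big1_seq ?addr0 => [|i /=]; last first.
  by rewrite mem_index_iota => /andP[mi _]; rewrite ltnNge mi andbF scale0r.
by apply: eq_big_nat => i ->.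
Qed.

(** [a'] is the concatenation of the lists [a j * b j]. By associativity of [op] its norm splits
    over the blocks, and block [j] contributes [|a j|] times 1: normalised blocks are isometric to
    the basis. *)
Lemma block_comb (V : lmodType R) (v : nat -> V) (g : nat -> nat)
    (b : nat -> nat -> R) n m a : (n <= m)%N ->
  (forall j, (n <= j < m)%N -> (g j <= g j.+1)%N /\ bnorm (g j) (g j.+1) (b j) = 1) ->
  exists a', (g n <= g m)%N /\
    \sum_(g n <= i < g m) a' i *: v i =
      \sum_(n <= j < m) a j *: \sum_(g j <= i < g j.+1) b j i *: v i /\
    bnorm (g n) (g m) a' = bnorm n m a.
Proof.
elim: m => [|m IH].
  by rewrite leqn0 => /eqP-> _; exists a; rewrite !bnormnn !big_geq.
rewrite leq_eqVlt => /orP[/eqP-> _|nm H].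
  by exists a; rewrite !bnormnn !big_geq.
have [j /andP[nj jm]|a' [gnm [a'v a'n]]] := IH nm.
  by apply: H; rewrite nj ltnW.
have [gm bm] : (g m <= g m.+1)%N /\ bnorm (g m) (g m.+1) (b m) = 1.
  by apply: H; rewrite -ltnS nm ltnSn.
exists (fun i => if (i < g m)%N then a' i else a m * b m i); split.
  exact: leq_trans gm.
split.
  rewrite (@big_cat_nat _ _ _ (g m))//= big_nat_recr//= -a'v scaler_sumr.
  congr (_ + _); first by apply: eq_big_nat => i /andP[_ ->].
  by apply: eq_big_nat => i /andP[gi _]; rewrite ltnNge gi scalerA.
rewrite (@bnorm_cat (g m)) ?gnm// bnormS//; congr op.
  by rewrite -a'n; apply: eq_bnorm => i /andP[_ ->].
rewrite -[RHS]mulr1 -bm -bnormZ; apply: eq_bnorm => i /andP[gi _].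
by rewrite ltnNge gi.
Qed.

End BlockNorm.

Lemma bnorm_add (R : realType) n m (a : nat -> R) : (n <= m)%N ->
  bnorm +%R n m a = \sum_(n <= i < m) `|a i|.
Proof.
elim: m => [|m IH]; first by rewrite leqn0 => /eqP->; rewrite bnormnn big_geq.
rewrite leq_eqVlt => /orP[/eqP->|nm]; first by rewrite bnormnn big_geq.
by rewrite bnormS// big_nat_recr//= IH.
Qed.

Section Seminorm.
Variables (R : realType) (V : lmodType R) (p : V -> R).
Hypothesis pP : is_seminorm p.

Lemma seminormZ a v : p (a *: v) = `|a| * p v.
Proof. by case: pP. Qed.

Lemma seminormD u v : p (u + v) <= p u + p v.
Proof. by case: pP. Qed.

Lemma seminorm0 : p 0 = 0.
Proof. by rewrite -(scale0r 0) seminormZ normr0 mul0r. Qed.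

Lemma seminormN v : p (- v) = p v.
Proof. by rewrite -scaleN1r seminormZ normrN1 mul1r. Qed.

Lemma seminorm_ge0 v : 0 <= p v.
Proof.
have := seminormD v (- v); rewrite subrr seminorm0 seminormN; lra.
Qed.

Lemma seminorm_sum n m (v : nat -> V) :
  p (\sum_(n <= i < m) v i) <= \sum_(n <= i < m) p (v i).
Proof.
elim/big_ind2: _ => // [|x s y t xs yt]; first by rewrite seminorm0.
by apply: le_trans (seminormD _ _) _; exact: lerD.
Qed.

Definition inspan (e : nat -> V) (d d' : nat) (v : V) :=
  exists c : nat -> R, v = \sum_(d <= i < d') c i *: e i.

Lemma inspan_widen e d d' k l v : (k <= d <= d')%N -> (d' <= l)%N ->
  inspan e d d' v -> inspan e k l v.
Proof.
move=> kd dl [c ->]; exists (fun i => if (d <= i < d')%N then c i else 0).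
by rewrite sum_restrict.
Qed.

Lemma inspanD e d d' u v : inspan e d d' u -> inspan e d d' v ->
  inspan e d d' (u + v).
Proof.
move=> [c ->] [c' ->]; exists (fun i => c i + c' i).
by rewrite -big_split/=; apply: eq_bigr => i _; rewrite scalerDl.
Qed.

Lemma inspanZ e d d' a v : inspan e d d' v -> inspan e d d' (a *: v).
Proof.
move=> [c ->]; exists (fun i => a * c i).
by rewrite scaler_sumr; apply: eq_bigr => i _; rewrite scalerA.
Qed.

Lemma inspan0 e d d' : inspan e d d' 0.
Proof. by exists (fun=> 0); rewrite big1// => i _; rewrite scale0r. Qed.

Lemma inspan_sum e d d' n m (v : nat -> V) :
  (forall i, (n <= i < m)%N -> inspan e d d' (v i)) ->
  inspan e d d' (\sum_(n <= i < m) v i).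
Proof.
move=> H; rewrite big_seq; elim/big_ind: _ => [|x y|i]; first exact: inspan0.
  exact: inspanD.
by rewrite mem_index_iota => /H.
Qed.

End Seminorm.

Section Blocks.
Variables (R : realType) (op : R -> R -> R) (V : lmodType R) (e : nat -> V).
Hypothesis opP : norm_op op.
Hypothesis spanE : forall v : V, exists n, inspan e 0 n v.

Lemma block_vanish (v : nat -> V) (D s : nat) :
  exists m b D', [/\ (s < m)%N, (D <= D')%N, bnorm op s m b = 1 &
    inspan e D D' (\sum_(s <= i < m) b i *: v i)].
Proof.
have /choice[n /choice[c vE]] : forall i, exists n c, v i = \sum_(0 <= k < n) c k *: e k.
  by move=> i; exact: spanE.
pose N := (D + \sum_(s <= i < s + D.+1) n i)%N.
pose c' i k := if (0 <= k < n i)%N then c i k else 0.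
have vE' i : (s <= i < s + D.+1)%N -> v i = \sum_(0 <= k < N) c' i k *: e k.
  move=> si; rewrite vE -(@sum_restrict _ _ _ 0 0 (n i) N)//.
  rewrite /N (bigD1_seq i)/=; first by lia.
    by rewrite mem_index_iota.
  exact: iota_uniq.
(* With [D.+1] rows and [D] columns, [A] has a nonzero left kernel vector: the coefficients of a
   combination without its first [D] coordinates. *)
pose A := \matrix_(i < D.+1, k < D) c' (s + i)%N k.
have /rowV0Pn[x /sub_kermxP xA x0] : kermx A != 0.
  by rewrite kermx_eq0 /row_free neq_ltn ltnS rank_leq_col.
pose b0 i := x 0 (inord (i - s)).
have b0A k : (k < D)%N -> \sum_(s <= i < s + D.+1) b0 i * c' i k = 0.
  move=> kD; have := congr1 (fun B : 'rV_D => B 0 (Ordinal kD)) xA; rewrite !mxE => xA0.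
  transitivity (\sum_j x 0 j * A j (Ordinal kD)) => // {xA0}.
  rewrite -{1}[s]add0n big_addn addKn big_mkord; apply: eq_bigr => i _.
  by rewrite !mxE /b0 addnK inord_val addnC.
have Nb : 0 < bnorm op s (s + D.+1) b0.
  have [j xj] : exists j, x 0 j != 0 by apply/rV0Pn.
  apply: lt_le_trans (bnorm_ub opP b0 (_ : (s <= s + j < s + D.+1)%N)).
    by rewrite /b0 addKn inord_val normr_gt0.
  by rewrite leq_addr ltn_add2l ltn_ord.
pose K := (bnorm op s (s + D.+1) b0)^-1.
exists (s + D.+1)%N, (fun i => K * b0 i), N; split.
- by rewrite -addSnnS leq_addr.
- exact: leq_addr.
- by rewrite bnormZ// ger0_norm ?invr_ge0 ?(ltW Nb)// mulVf// gt_eqF.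
under eq_bigr do rewrite -scalerA.
rewrite -scaler_sumr; apply: inspanZ.
exists (fun k => \sum_(s <= i < s + D.+1) b0 i * c' i k).
transitivity (\sum_(s <= i < s + D.+1) \sum_(0 <= k < N) (b0 i * c' i k) *: e k).
  apply: eq_big_nat => i si; rewrite (vE' _ si) scaler_sumr.
  by apply: eq_bigr => k _; rewrite scalerA.
rewrite exchange_big/= (@big_cat_nat _ _ _ D 0 N)//= ?leq_addr//.
rewrite big1_seq ?add0r => [|k]; last first.
  by rewrite mem_index_iota /= => kD; rewrite -scaler_suml b0A// scale0r.
by apply: eq_bigr => k _; rewrite -scaler_suml.
Qed.

Lemma blocks_exist (v : nat -> V) : exists (g D : nat -> nat) (b : nat -> nat -> R),
  forall j, [/\ (g j < g j.+1)%N, (D j <= D j.+1)%N, bnorm op (g j) (g j.+1) (b j) = 1 &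
    inspan e (D j) (D j.+1) (\sum_(g j <= i < g j.+1) b j i *: v i)].
Proof.
have : forall q : nat * nat, exists r : nat * nat * (nat -> R),
    [/\ (q.1 < r.1.1)%N, (q.2 <= r.1.2)%N, bnorm op q.1 r.1.1 r.2 = 1 &
      inspan e q.2 r.1.2 (\sum_(q.1 <= i < r.1.1) r.2 i *: v i)].
  move=> [s D]; have [m [b [D' H]]] := block_vanish v D s.
  by exists (m, D', b).
move=> /choice[f fP]; pose q j := iter j (fun q => (f q).1) (0, 0)%N.
exists (fun j => (q j).1), (fun j => (q j).2), (fun j => (f (q j)).2) => j.
exact: fP.
Qed.

End Blocks.

(** * James' distortion argument *)

Section James.
Variables (R : realType) (V : lmodType R) (p : V -> R) (e : nat -> V).
Hypothesis pP : is_seminorm p.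

Definition equiv_seq (op : R -> R -> R) (c C : R) (w : nat -> V) :=
  forall n m a, (n <= m)%N ->
    c * bnorm op n m a <= p (\sum_(n <= i < m) a i *: w i) <= C * bnorm op n m a.

Definition block_seq (D : nat -> nat) (w : nat -> V) :=
  forall j, (D j <= D j.+1)%N /\ inspan e (D j) (D j.+1) (w j).

Lemma block_seq_homo D w : block_seq D w -> {homo D : i j / (i <= j)%N}.
Proof. by move=> Dw; apply: homo_leq => [//|i j k|i]; [exact: leq_trans|case: (Dw i)]. Qed.

Lemma block_equiv_exist op c C v : norm_op op ->
  (forall x : V, exists n, inspan e 0 n x) -> equiv_seq op c C v ->
  exists w D, block_seq D w /\ equiv_seq op c C w.
Proof.
move=> opP spanE vE; have [g [D [b H]]] := blocks_exist opP spanE v.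
exists (fun j => \sum_(g j <= i < g j.+1) b j i *: v i), D.
split=> [j|n m a nm]; first by have [] := H j.
have [|a' [gnm [<- <-]]] := @block_comb R op opP V v g b n m a nm.
  by move=> j _; have [/ltnW] := H j.
exact: vE.
Qed.

(** [good j] will say that block [j] nearly attains the asymptotic constant, and [tail j n] that the
    estimate with tolerance [eps j] holds from index [n] on. *)
Lemma james_select op (w : nat -> V) (good : nat -> R -> Prop) (tail : nat -> nat -> Prop) :
  norm_op op ->
  (forall j n, exists n' m a, [/\ (n <= n' <= m)%N, bnorm op n' m a = 1 &
     good j (p (\sum_(n' <= i < m) a i *: w i))]) ->
  (forall j, exists N, forall n, (N <= n)%N -> tail j n) ->
  exists g b, forall j, [/\ (g j < g j.+1)%N, bnorm op (g j) (g j.+1) (b j) = 1,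
    good j (p (\sum_(g j <= i < g j.+1) b j i *: w i)) & tail j (g j)].
Proof.
move=> opP goodP tailP.
have : forall js : nat * nat, exists r : nat * (nat -> R),
    [/\ (js.2 < r.1)%N, bnorm op js.2 r.1 r.2 = 1,
      good js.1 (p (\sum_(js.2 <= i < r.1) r.2 i *: w i)) & tail js.1.+1 r.1].
  move=> [j s]; have [n' [m [a [/andP[sn nm] an ga]]]] := goodP j s.
  have [N HN] := tailP j.+1.
  (* Padding the block with zeros pushes its end, where the next block starts, into the range of the
     next tail estimate. *)
  exists (maxn m (maxn N s.+1), fun i => if (n' <= i < m)%N then a i else 0); split=> /=.
  - by rewrite !leq_max leqnn !orbT.
  - by rewrite bnorm_restrict ?sn// leq_maxl.
  - by rewrite sum_restrict ?sn// leq_maxl.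
  - by apply: HN; rewrite !leq_max leqnn orbT.
move=> /choice[f fP]; have [N0 HN0] := tailP 0%N.
pose g := fix g j := if j is i.+1 then (f (i, g i)).1 else N0.
exists g, (fun j => (f (j, g j)).2) => j.
have tailg : tail j (g j) by case: j => [|j]; [exact: HN0|have [] := fP (j, g j)].
by have [? ? ? _] := fP (j, g j); split.
Qed.

(** Each [u j] is a selected block divided by [K]. By [block_comb], a combination starting at [u n]
    is, up to this factor, a combination of [w] starting at [g n] with the same coefficient norm, so
    the tail estimate number [n] applies. *)
Lemma james_blocks op w D K (good : nat -> R -> Prop) (T : nat -> R -> R -> Prop) :
  norm_op op -> 0 < K -> block_seq D w ->
  (forall j n, exists n' m a, [/\ (n <= n' <= m)%N, bnorm op n' m a = 1 &
     good j (p (\sum_(n' <= i < m) a i *: w i))]) ->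
  (forall j, exists N, forall n m a, (N <= n <= m)%N ->
     T j (bnorm op n m a) (p (\sum_(n <= i < m) a i *: w i))) ->
  exists u D', [/\ block_seq D' u, forall j, good j (K * p (u j)) &
    forall n m a, (n <= m)%N ->
      T n (bnorm op n m a) (K * p (\sum_(n <= i < m) a i *: u i))].
Proof.
move=> opP K0 wD goodP tailP.
pose tail j n := forall m a, (n <= m)%N ->
  T j (bnorm op n m a) (p (\sum_(n <= i < m) a i *: w i)).
have [j|g [b gb]] := james_select (tail := tail) opP goodP.
  have [N HN] := tailP j; exists N => n Nn m a nm.
  by apply: HN; rewrite Nn.
have KK x : K * p (K^-1 *: x) = p x.
  by rewrite seminormZ// gtr0_norm ?invr_gt0// mulrA divff ?mul1r// gt_eqF.
have Dh := block_seq_homo wD.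
exists (fun j => K^-1 *: \sum_(g j <= i < g j.+1) b j i *: w i), (D \o g); split.
- move=> j; have [gj _ _ _] := gb j; split; first by apply: Dh; exact: ltnW.
  apply: inspanZ; apply: inspan_sum => i /andP[gi ig]; apply: inspanZ.
  by have [Di] := wD i; apply: inspan_widen; rewrite ?Di ?andbT; apply: Dh.
- by move=> j; rewrite KK; have [] := gb j.
- move=> n m a nm; under eq_bigr do rewrite scalerA mulrC -scalerA.
  rewrite -scaler_sumr KK.
  have [|a' [gnm [<- <-]]] := @block_comb R op opP V w g b n m a nm.
    by move=> j _; have [/ltnW] := gb j.
  by have [_ _ _] := gb n; apply.
Qed.

Lemma bnorm_cst1 op n : norm_op op -> bnorm op n n.+1 (fun=> 1 : R) = 1.
Proof. by move=> opP; rewrite bnorm1// normr1. Qed.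

(** [K] is the supremum of the lower constants valid on some tail: smaller constants work
    eventually, larger ones fail on every tail. It is at least [c], and single vectors bound it by
    [C]. *)
Lemma james_lower op c C w : norm_op op -> 0 < c -> equiv_seq op c C w ->
  exists2 K, 0 < K &
    (forall k, k < K -> exists N, forall n m a, (N <= n <= m)%N ->
      k * bnorm op n m a <= p (\sum_(n <= i < m) a i *: w i)) /\
    (forall k, K < k -> forall N, exists n m a, (N <= n <= m)%N /\
      p (\sum_(n <= i < m) a i *: w i) < k * bnorm op n m a).
Proof.
move=> opP c0 wE.
pose A := [set k | exists N, forall n m a, (N <= n <= m)%N ->
  k * bnorm op n m a <= p (\sum_(n <= i < m) a i *: w i)].
have Ac : A c by exists 0%N => n m a /andP[_ nm]; have /andP[] := wE n m a nm.
have AC : ubound A C.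
  move=> k [N /(_ N N.+1 (fun=> 1))]; rewrite leqnn leqnSn => /(_ isT).
  have /andP[_] := wE N N.+1 (fun=> 1) (leqnSn N).
  by rewrite bnorm_cst1// !mulr1 => /[swap]; exact: le_trans.
have cK : c <= sup A by apply: ub_le_sup => //; exists C.
exists (sup A); first exact: lt_le_trans cK.
split=> [k kK|k Kk N].
  have [|k' [N HN] kk'] := sup_gt _ kK; first by exists c.
  exists N => n m a Nnm; apply: le_trans (HN n m a Nnm).
  by rewrite ler_wpM2r ?bnorm_ge0// ltW.
apply: contrapT => H; suff : A k by move=> /(ub_le_sup (ex_intro _ C AC)); rewrite leNgt Kk.
exists N => n m a Nnm; rewrite leNgt; apply/negP => lt; apply: H.
by exists n, m, a.
Qed.

Lemma james_upper op c C w : norm_op op -> 0 < c -> equiv_seq op c C w ->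
  exists2 K, 0 < K &
    (forall k, K < k -> exists N, forall n m a, (N <= n <= m)%N ->
      p (\sum_(n <= i < m) a i *: w i) <= k * bnorm op n m a) /\
    (forall k, k < K -> forall N, exists n m a, (N <= n <= m)%N /\
      k * bnorm op n m a < p (\sum_(n <= i < m) a i *: w i)).
Proof.
move=> opP c0 wE.
pose A := [set k | exists N, forall n m a, (N <= n <= m)%N ->
  p (\sum_(n <= i < m) a i *: w i) <= k * bnorm op n m a].
have AC : A C by exists 0%N => n m a /andP[_ nm]; have /andP[] := wE n m a nm.
have Ac : lbound A c.
  move=> k [N /(_ N N.+1 (fun=> 1))]; rewrite leqnn leqnSn => /(_ isT).
  have /andP[+ _] := wE N N.+1 (fun=> 1) (leqnSn N).
  by rewrite bnorm_cst1// !mulr1; exact: le_trans.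
have cK : c <= inf A by apply: lb_le_inf => //; exists C.
exists (inf A); first exact: lt_le_trans cK.
split=> [k kK|k Kk N].
  have [|k' [N HN] kk'] := inf_lt _ kK; first by exists C.
  exists N => n m a Nnm; apply: le_trans (HN n m a Nnm) _.
  by rewrite ler_wpM2r ?bnorm_ge0// ltW.
apply: contrapT => H; suff : A k by move=> /(ge_inf (ex_intro _ c Ac)); rewrite leNgt Kk.
exists N => n m a Nnm; rewrite leNgt; apply/negP => lt; apply: H.
by exists n, m, a.
Qed.

(** The factor 3 is what the lower estimate for c_0 costs:
    [2 * (1 - eps) - (1 + eps) = 1 - 3 * eps]. *)
Definition almost_isometric (op : R -> R -> R) (eps : nat -> R) (u : nat -> V) :=
  forall n m a, (n <= m)%N ->
    `|p (\sum_(n <= i < m) a i *: u i) - bnorm op n m a| <= 3 * eps n * bnorm op n m a.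

Variable eps : nat -> R.
Hypotheses (eps_gt0 : forall n, 0 < eps n)
  (eps_noninc : forall i j, (i <= j)%N -> eps j <= eps i).

Lemma normalize_block op c C w n m a : norm_op op -> 0 < c -> equiv_seq op c C w ->
  (n <= m)%N -> bnorm op n m a != 0 ->
  exists2 a', bnorm op n m a' = 1 &
    p (\sum_(n <= i < m) a' i *: w i) = p (\sum_(n <= i < m) a i *: w i) / bnorm op n m a.
Proof.
move=> opP c0 wE nm a0.
have {}a0 : 0 < bnorm op n m a by rewrite lt_def a0 bnorm_ge0.
exists (fun i => (bnorm op n m a)^-1 * a i).
  by rewrite bnormZ// gtr0_norm ?invr_gt0// mulVf// gt_eqF.
under eq_bigr do rewrite -scalerA.
by rewrite -scaler_sumr seminormZ// gtr0_norm ?invr_gt0// mulrC.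
Qed.

(** The blocks nearly attain the best lower constant. The lower estimate is then the tail property,
    and the upper one is the triangle inequality, each normalised block having seminorm at most
    [1 + eps]. *)
Lemma almost_isometric_add c C w D : 0 < c -> equiv_seq +%R c C w -> block_seq D w ->
  exists u D', block_seq D' u /\ almost_isometric +%R eps u.
Proof.
move=> c0 wE wD; have opP := norm_op_add R.
have [K K0 [lowK upK]] := james_lower opP c0 wE.
have [j n|j|u [D' [uD' ub lb]]] := @james_blocks +%R w D K
  (fun j x => x <= (1 + eps j) * K) (fun j x y => (1 - eps j) * K * x <= y) opP K0 wD.
- have [|n' [m [a [nn lt]]]] := upK ((1 + eps j) * K) _ n.
    by rewrite ltr_pMl// ltrDl.
  have /andP[_ nm] := nn.
  have a0 : bnorm +%R n' m a != 0.
    by apply: contraTneq lt => ->; rewrite mulr0 -leNgt seminorm_ge0.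
  have [a' a'1 pa'] := normalize_block opP c0 wE nm a0.
  exists n', m, a'; split=> //; rewrite pa' ler_pdivrMr ?ltW//.
  by rewrite lt_def a0 bnorm_ge0.
- have [|N HN] := lowK ((1 - eps j) * K); first by rewrite gtr_pMl// gtrBl.
  by exists N => n m a /HN.
exists u, D'; split=> // n m a nm.
have := lb n m a nm; rewrite mulrAC [K * p _]mulrC ler_pM2r// => lbn.
have ubn : p (\sum_(n <= i < m) a i *: u i) <= (1 + eps n) * bnorm +%R n m a.
  apply: le_trans (seminorm_sum pP _ _ _) _.
  rewrite bnorm_add//.
  rewrite mulr_sumr !big_nat; apply: ler_sum => i /andP[ni im].
  rewrite seminormZ// mulrC ler_wpM2r//.
  have := ub i; rewrite mulrC ler_pM2r// => /le_trans; apply.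
  by rewrite lerD2l eps_noninc.
have := bnorm_ge0 opP n m a; have := eps_gt0 n.
move: lbn ubn; set x := p _; set y := bnorm _ _ _ _; set d := eps n => lbn ubn d0 y0.
have := mulr_ge0 (ltW d0) y0; rewrite ler_norml.
by move: lbn ubn; rewrite !mulrDl mulNr -mulrA; set z := d * y; move=> *; apply/andP; split; lra.
Qed.

Lemma bnorm_max_attained n m (a : nat -> R) : (n <= m)%N ->
  bnorm Num.max n m a = 0 \/
  exists2 k, (n <= k < m)%N & bnorm Num.max n m a = `|a k|.
Proof.
elim: m => [|m IH]; first by rewrite leqn0 => /eqP->; left; rewrite bnormnn.
rewrite leq_eqVlt => /orP[/eqP->|nm]; first by left; rewrite bnormnn.
rewrite bnormS//; have [le|lt] := leP `|a m| (bnorm Num.max n m a); last first.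
  by right; exists m => //; rewrite -ltnS nm ltnSn.
have [->|[k /andP[nk km] ->]] := IH nm; first by left.
by right; exists k => //; rewrite nk leqW.
Qed.

(** Dually, the blocks nearly attain the best upper constant and the upper estimate is the tail
    property. For the lower one, reversing all signs except at a largest coefficient [a k] keeps the
    coefficient norm, and the two vectors add up to [2 * a k] times [u k], whose seminorm is known
    from below. *)
Lemma almost_isometric_max c C w D : 0 < c -> equiv_seq Num.max c C w -> block_seq D w ->
  exists u D', block_seq D' u /\ almost_isometric Num.max eps u.
Proof.
move=> c0 wE wD; have opP := norm_op_max R.
have [K K0 [upK lowK]] := james_upper opP c0 wE.
have [j n|j|u [D' [uD' lb ub]]] := @james_blocks Num.max w D K
  (fun j x => (1 - eps j) * K <= x) (fun j x y => y <= (1 + eps j) * K * x) opP K0 wD.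
- have [|n' [m [a [nn lt]]]] := lowK ((1 - eps j) * K) _ n.
    by rewrite gtr_pMl// gtrBl.
  have /andP[_ nm] := nn.
  have a0 : bnorm Num.max n' m a != 0.
    apply: contraTneq lt => a0; rewrite a0 mulr0 -leNgt.
    by have /andP[_] := wE n' m a nm; rewrite a0 mulr0.
  have [a' a'1 pa'] := normalize_block opP c0 wE nm a0.
  exists n', m, a'; split=> //; rewrite pa' ler_pdivlMr ?ltW//.
  by rewrite lt_def a0 bnorm_ge0.
- have [|N HN] := upK ((1 + eps j) * K); first by rewrite ltr_pMl// ltrDl.
  by exists N => n m a /HN.
exists u, D'; split=> // n m a nm.
have {}ub b : p (\sum_(n <= i < m) b i *: u i) <= (1 + eps n) * bnorm Num.max n m b.
  by have := ub n m b nm; rewrite mulrAC [K * p _]mulrC ler_pM2r.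
have := bnorm_max_attained a nm; set y := bnorm _ _ _ _ => -[y0|[k /andP[nk km] yk]].
  have := ub a; rewrite -/y y0 !mulr0 subr0 => pa.
  by rewrite ger0_norm ?seminorm_ge0.
(* [2 a_k u_k - sum] has the same coefficients up to sign *)
pose b i := if i == k then a k else - a i.
have bn : bnorm Num.max n m b = y.
  rewrite /y /bnorm; congr (iteri _ _ _); apply/funext => i; apply/funext => r.
  by rewrite /b; case: eqP => [->//|_]; rewrite normrN.
have kin : k \in index_iota n m by rewrite mem_index_iota nk.
have sb : \sum_(n <= i < m) b i *: u i = (2 * a k) *: u k - \sum_(n <= i < m) a i *: u i.
  rewrite (bigD1_seq k) ?iota_uniq//= [X in _ = _ - X](bigD1_seq k) ?iota_uniq//=.
  rewrite opprD addrA -scalerBl; congr (_ *: _ + _).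
    by rewrite /b eqxx mulr_natl mulr2n addrK.
  by rewrite -sumrN; apply: eq_bigr => i /negbTE ik; rewrite /b ik scaleNr.
have H1 := ub b; rewrite sb bn in H1.
have H2 := ub a; rewrite -/y in H2.
have : p ((2 * a k) *: u k) <= p ((2 * a k) *: u k - \sum_(n <= i < m) a i *: u i) +
    p (\sum_(n <= i < m) a i *: u i).
  by have := seminormD pP ((2 * a k) *: u k - \sum_(n <= i < m) a i *: u i)
    (\sum_(n <= i < m) a i *: u i); rewrite subrK.
rewrite seminormZ// normrM ger0_norm// -yk.
have uk : (1 - eps n) <= p (u k).
  have := lb k; rewrite [K * p _]mulrC ler_pM2r//; apply: le_trans.
  by rewrite lerD2l lerN2 eps_noninc.
have y0 : 0 <= y by exact: bnorm_ge0.
have := ler_wpM2l y0 uk; have := mulr_ge0 (ltW (eps_gt0 n)) y0.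
move: H1 H2; set x := p (\sum_(n <= i < m) a i *: u i); set x' := p (_ - _).
set d := eps n; rewrite ler_norml !mulrDl mulrBr -!mulrA [y * d]mulrC !mul1r mulr1.
set z := d * y; set t := y * p (u k); move=> *; apply/andP; split; lra.
Qed.

End James.

(** * The usual bases of l^1 and c_0 *)

Section SequenceNorms.
Variable R : realType.
Implicit Types (f a : nat -> R) (n m : nat).

Lemma ell1_norm_bnorm f n m a : (n <= m)%N ->
  (forall k, f k = if (n <= k < m)%N then a k else 0) ->
  ell1_norm f = bnorm +%R n m a.
Proof.
move=> nm fE; have opP := norm_op_add R.
rewrite /ell1_norm; apply: lim_near_cst => //.
exists m => // N /= mN; rewrite /series/= -bnorm_add//.
rewrite -(@bnorm_restrict R +%R opP 0 n m N a)//.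
by apply: eq_bnorm => i _; rewrite fE.
Qed.

Lemma sup_norm_bnorm f n m a : (n <= m)%N ->
  (forall k, f k = if (n <= k < m)%N then a k else 0) ->
  sup_norm f = bnorm Num.max n m a.
Proof.
move=> nm fE; have opP := norm_op_max R.
have ub : ubound (range (fun n => `|f n|)) (bnorm Num.max n m a).
  move=> _ [k _ <-]; rewrite fE; case: ifP => [|_]; first exact: bnorm_ub.
  by rewrite normr0 bnorm_ge0.
have hub : has_ubound (range (fun n => `|f n|)) by exists (bnorm Num.max n m a).
apply/le_anti/andP; split; first by apply: ge_sup => //; exists `|f 0%N|, 0%N.
have [->|[k nk ->]] := bnorm_max_attained a nm.
  by apply: le_trans (normr_ge0 (f 0%N)) _; apply: ub_le_sup => //; exists 0%N.
by apply: ub_le_sup => //; exists k => //; rewrite fE nk.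
Qed.

Lemma sum_unit n m a k :
  \sum_(n <= i < m) a i * (k == i)%:R = if (n <= k < m)%N then a k else 0.
Proof.
case: ifP => nk.
  rewrite (bigD1_seq k) ?mem_index_iota ?iota_uniq//= eqxx mulr1 big1 ?addr0// => i ik.
  by rewrite eq_sym (negbTE ik) mulr0.
rewrite big1_seq// => i /=; rewrite mem_index_iota => ni.
by case: eqP => [ki|]; rewrite ?mulr0//; move: nk; rewrite ki ni.
Qed.

Lemma c00_ell1 (x : c00 R) : (x : nat -> R) \in @ell1_pred R.
Proof.
have /c00P[N _ xN] := valP x; apply/ell1P/cvg_ex; exists (\sum_(0 <= i < N) `|x i|).
apply: cvg_near_cst; exists N => // n /= Nn.
rewrite /series/= (@big_cat_nat _ _ _ N)//= [X in _ + X]big1_seq ?addr0// => i /=.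
by rewrite mem_index_iota => /andP[Ni _]; rewrite xN// normr0.
Qed.

Lemma c00_c0 (x : c00 R) : (x : nat -> R) \in @c0_pred R.
Proof. by have /c00P xN := valP x; apply/c0P; exact: cvg_near_cst. Qed.

Lemma seminorm_ell1 : is_seminorm (fun x : c00 R => ell1_norm x).
Proof.
split=> [u v|a v].
- exact: (@ell1_normD R (Ell1 (c00_ell1 u)) (Ell1 (c00_ell1 v))).
- exact: (@ell1_normZ R a (Ell1 (c00_ell1 v))).
Qed.

Lemma seminorm_sup : is_seminorm (fun x : c00 R => sup_norm x).
Proof.
split=> [u v|a v].
- exact: (@c0_normD R (C0 (c00_c0 u)) (C0 (c00_c0 v))).
- exact: (@c0_normZ R a (C0 (c00_c0 v))).
Qed.

Lemma c00_sumE n m a k :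
  (\sum_(n <= i < m) a i *: usual_basis R i : c00 R) k =
  if (n <= k < m)%N then a k else 0.
Proof.
rewrite -sum_unit.
by rewrite (big_morph (fun x : c00 R => x k) (id1 := 0) (op1 := +%R)).
Qed.

Lemma hamel_usual_basis : hamel_basis (@usual_basis R).
Proof.
split=> [n a a0 i|v].
  pose b k := if insub k is Some j then a j else 0.
  have bE (j : 'I_n) : b j = a j by rewrite /b valK.
  have : (\sum_(0 <= i < n) b i *: usual_basis R i : c00 R) i = b i.
    by rewrite c00_sumE ltn_ord.
  rewrite big_mkord bE; under eq_bigr do rewrite bE.
  by rewrite a0.
have /c00P[N _ vN] := valP v; exists N, (fun i => v i).
rewrite -(big_mkord xpredT (fun i => v i *: usual_basis R i)).
apply/val_inj/funext => k /=; rewrite c00_sumE /=.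
by case: ltnP => // Nk; rewrite vN.
Qed.

Lemma unit_seq_ell1 j : (fun n => (n == j)%:R) \in @ell1_pred R.
Proof. exact: (c00_ell1 (usual_basis R j)). Qed.

Lemma unit_seq_c0 j : (fun n => (n == j)%:R) \in @c0_pred R.
Proof. exact: (c00_c0 (usual_basis R j)). Qed.

Lemma norm_ell1_basis n m a : (n <= m)%N ->
  `|\sum_(n <= i < m) a i *: Ell1 (unit_seq_ell1 i)| = bnorm +%R n m a.
Proof.
move=> nm; apply: (ell1_norm_bnorm nm) => k; rewrite -sum_unit.
by rewrite (big_morph (fun x : ell1 R => x k) (id1 := 0) (op1 := +%R)).
Qed.

Lemma norm_c0_basis n m a : (n <= m)%N ->
  `|\sum_(n <= i < m) a i *: C0 (unit_seq_c0 i)| = bnorm Num.max n m a.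
Proof.
move=> nm; apply: (sup_norm_bnorm nm) => k; rewrite -sum_unit.
by rewrite (big_morph (fun x : c0 R => x k) (id1 := 0) (op1 := +%R)).
Qed.

End SequenceNorms.

(* A perturbation of size c/2 in the l^1 sense keeps the equivalence: the
   coefficients are bounded by the norm for both norm operations. *)
Lemma copy_equiv_seq (R : realType) (V : lmodType R) (p : V -> R)
    (E Y : normedModType R) (iota : {linear V -> E}) (op : R -> R -> R) (y : nat -> Y) :
  norm_op op -> (forall v, `|iota v| = p v) -> dense (range iota) ->
  (forall n m a, (n <= m)%N -> `|\sum_(n <= i < m) a i *: y i| = bnorm op n m a) ->
  contains_isomorphic_copy Y E ->
  exists c C v, 0 < c /\ equiv_seq p op c C v.
Proof.
move=> opP iotap dE yN [T [c [C [c0 TC]]]].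
(* Written as differences, these radii telescope to at most [c / 2] over any range. *)
pose r i : R := c / 2 * (2^-1 ^+ i - 2^-1 ^+ i.+1).
have r0 i : 0 < r i.
  by rewrite /r exprS mulr_gt0 ?divr_gt0// -{1}[_ ^+ i]mul1r -mulrBl mulr_gt0 ?exprn_gt0//; lra.
have : forall i, exists v, `|T (y i) - iota v| < r i.
  move=> i; have ne : ball (T (y i)) (r i) !=set0 by exists (T (y i)); exact: ballxx.
  have [z [zr [v _ vz]]] := dE _ ne (ball_open _ _).
  by exists v; move: zr; rewrite -vz -ball_normE.
move=> /choice[v vP]; exists (c / 2), (C + c / 2), v; split; first by rewrite divr_gt0.
move=> n m a nm; rewrite -iotap linear_sum.
under eq_bigr do rewrite linearZ/=.
have Ts : T (\sum_(n <= i < m) a i *: y i) = \sum_(n <= i < m) a i *: T (y i).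
  by rewrite linear_sum; apply: eq_bigr => i _; rewrite linearZ.
have /andP[] := TC (\sum_(n <= i < m) a i *: y i); rewrite yN// Ts.
have N0 := bnorm_ge0 opP n m a.
have : `|\sum_(n <= i < m) a i *: T (y i) - \sum_(n <= i < m) a i *: iota (v i)|
    <= c / 2 * bnorm op n m a.
  rewrite -sumrB; apply: le_trans (ler_norm_sum _ _ _) _.
  apply: (@le_trans _ _ (\sum_(n <= i < m) bnorm op n m a * r i)).
    rewrite !big_nat; apply: ler_sum => i nim; rewrite -scalerBr normrZ.
    by rewrite ler_pM// ?(ltW (vP i))//; exact: bnorm_ub.
  rewrite -mulr_sumr mulrC ler_wpM2r// -mulr_sumr ler_piMr//; first by rewrite divr_ge0// ltW.
  rewrite -(opprK (\sum_(_ <= _ < _) _)) -sumrN.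
  under eq_bigr do rewrite opprB.
  rewrite telescope_sumr// opprB.
  have : (2^-1 : R) ^+ n <= 1 by rewrite exprn_ile1//; lra.
  have : 0 <= (2^-1 : R) ^+ m by rewrite exprn_ge0//.
  lra.
set X := \sum_(n <= i < m) a i *: T (y i); set Z := \sum_(n <= i < m) a i *: iota (v i).
have h1 : `|X| <= `|X - Z| + `|Z| by rewrite -{1}(subrK Z X) ler_normD.
have h2 : `|Z| <= `|X - Z| + `|X|.
  by rewrite distrC -{1}(subrK X Z) ler_normD.
move=> h3 h4 h5; rewrite mulrDl; set b := bnorm _ _ _ _ in h3 h4 h5 *.
have : c / 2 * b = c * b / 2 by rewrite mulrAC.
by move=> cb; rewrite cb in h3 *; apply/andP; split; lra.
Qed.

(** * Invariance under spreading *)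

(* The conditions on the pair of increasing lists [s, t] in a plegma tuple
   where [s] comes before [t]. *)
Definition plegma_rel (s t : seq nat) : Prop :=
  [/\ forall k, (k < size s)%N -> (k < size t)%N -> (nth 0 s k < nth 0 t k)%N,
      forall k, (k < size s)%N -> (k.+1 < size t)%N -> (nth 0 s k < nth 0 t k.+1)%N
    & forall k, (k < size t)%N -> (k.+1 < size s)%N -> (nth 0 t k < nth 0 s k.+1)%N].

Lemma plegma_of_rel l (s : l.-tuple {fset nat}) :
  (forall i, tnth s i != fset0) ->
  (forall i j : 'I_l, (i < j)%N -> plegma_rel (els (tnth s i)) (els (tnth s j))) ->
  plegma s.
Proof.
move=> s0 sP; split=> // [i j [//|k] ij|i j [//|k]] /=.
  by rewrite -!size_els leq_min !feltE => /andP[ki kj]; case: (sP i j ij) => + _ _; apply.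
rewrite -!size_els leq_min !feltE ltn_subRL add1n => /andP[ki kj].
case: (ltngtP i j) => [ij|ji|/val_inj ij].
- by case: (sP i j ij) => _ + _; apply.
- by case: (sP j i ji) => _ _; apply.
- by have /(sortedP 0%N) := els_sorted (tnth s j); rewrite ij; apply.
Qed.

Section Generated.
Variables (R : realType) (X : normedModType R) (F : set {fset nat}) (M : set nat).
Variables (x : {fset nat} -> X) (V : lmodType R) (p : V -> R) (e : nat -> V).
Hypothesis pP : is_seminorm p.
Variable delta : nat -> R.
Hypothesis delta_gt0 : forall n, 0 < delta n.
Hypothesis deltaP : forall k l, (1 <= k <= l)%N ->
  forall s : k.-tuple {fset nat}, plegma s ->
    (forall j, restrict_family F M (tnth s j)) ->
    (selt M l <= felt (head fset0 s) 1)%N ->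
  forall a : 'I_k -> R, (forall j, -1 <= a j <= 1) ->
    `| `|\sum_(j < k) a j *: x (tnth s j)| - p (\sum_(j < k) a j *: e j) | <= delta l.

(** Generation only allows coefficients in [-1, 1]; by homogeneity, coefficients up to [B] cost a
    factor [B] in the error. *)
Lemma generates_seq (T : Type) (q0 : T) (Q : seq T) (c : T -> R) (t : T -> {fset nat})
    (l : nat) (B : R) : 0 < B -> (size Q <= l)%N ->
  (forall i, (i < size Q)%N -> let q := nth q0 Q i in
    [/\ t q != fset0, restrict_family F M (t q),
      (selt M l <= felt (t q) 1)%N & `|c q| <= B]) ->
  (forall i j, (i < j < size Q)%N ->
     plegma_rel (els (t (nth q0 Q i))) (els (t (nth q0 Q j)))) ->
  `| `|\sum_(q <- Q) c q *: x (t q)| -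
     p (\sum_(0 <= j < size Q) c (nth q0 Q j) *: e j) | <= B * delta l.
Proof.
move=> B0 Ql QP Qpl.
have [Q0|Q1] := posnP (size Q).
  rewrite (size0nil Q0) big_nil big_geq// normr0 seminorm0// subr0 normr0.
  by rewrite mulr_ge0// ltW.
pose k := size Q; have kl : (1 <= k <= l)%N by rewrite Q1.
have sz : size (map t Q) == k by rewrite size_map.
pose s := Tuple sz; pose a (j : 'I_k) := c (nth q0 Q j) / B.
have sE (j : 'I_k) : tnth s j = t (nth q0 Q j).
  by rewrite (tnth_nth fset0)/= (nth_map q0).
have spl : plegma s.
  apply: plegma_of_rel => [i|i j ij]; rewrite !sE; first by have [] := QP i (ltn_ord i).
  by apply: Qpl; rewrite ij ltn_ord.
have sF j : restrict_family F M (tnth s j) by rewrite sE; have [] := QP j (ltn_ord j).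
have sM : (selt M l <= felt (head fset0 s) 1)%N.
  have -> : head fset0 s = t (nth q0 Q 0).
    by rewrite -(nth_map q0 fset0)// nth0.
  by have [] := QP 0%N Q1.
have a1 j : -1 <= a j <= 1.
  rewrite -ler_norml /a normrM normfV (gtr0_norm B0) ler_pdivrMr// mul1r.
  by have [] := QP j (ltn_ord j).
have := deltaP kl spl sF sM a1.
have -> : \sum_(j < k) a j *: x (tnth s j) = B^-1 *: \sum_(q <- Q) c q *: x (t q).
  rewrite (big_nth q0) big_mkord scaler_sumr; apply: eq_bigr => j _.
  by rewrite sE scalerA mulrC.
have -> : \sum_(j < k) a j *: e j = B^-1 *: \sum_(0 <= j < size Q) c (nth q0 Q j) *: e j.
  rewrite big_mkord scaler_sumr; apply: eq_bigr => j _.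
  by rewrite scalerA mulrC.
have Bi : `|B^-1| = B^-1 by rewrite gtr0_norm ?invr_gt0.
rewrite normrZ seminormZ// !Bi -mulrBr normrM Bi.
by rewrite ler_pdivrMl.
Qed.

Hypothesis delta_cvg0 : delta n @[n --> \oo] --> 0.
Hypotheses (rtF : regular_thin F) (Fn0 : F !=set0) (F0 : ~ F fset0).
Variable lam : nat -> nat.
Hypotheses (lamP : good_enum F lam) (Mlam : forall n, M (lam n)).

Lemma F_neq0 s : F s -> s != fset0.
Proof. by move=> Fs; apply/eqP => s0; apply: F0; rewrite -s0. Qed.

Lemma delta_small B eps : 0 < eps -> 0 < B ->
  exists N, forall n, (N <= n)%N -> B * delta n <= eps.
Proof.
move=> eps0 B0; have /cvgrPdist_le/(_ (eps / B)) := delta_cvg0.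
rewrite divr_gt0// => /(_ isT)[N _ HN]; exists N => n Nn.
rewrite mulrC -ler_pdivlMr//; have := HN n Nn; rewrite /= sub0r normrN.
by rewrite gtr0_norm.
Qed.

Lemma long_plegma l : exists sg : nat -> {fset nat}, forall j, (j < l)%N ->
  [/\ F (sg j), restrict_family F M (sg j), (selt M l <= felt (sg j) 1)%N &
    forall j', (j < j' < l)%N -> plegma_rel (els (sg j)) (els (sg j'))].
Proof.
have [lamh lam0 _] := lamP.
(* For [j < l], the [i]-th points lie in one window of length [l.+1], ordered by [j]; successive
   windows give the crossing inequalities, whatever the lengths [r j]. Starting at [l] takes care of
   [selt M l]. *)
pose f j i := (l + i * l.+1 + j)%N.
have fh j : {homo f j : i i' / (i < i')%N}.
  by move=> i i' ii'; rewrite /f ltn_add2r ltn_add2l ltn_pmul2r.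
have /choice[r rP] : forall j, exists r, F (fs (map lam (mkseq (f j) r))).
  by move=> j; exact: (cut_infinite rtF Fn0 lamP).
pose sg j := fs (map lam (mkseq (f j) (r j))).
have sgE j : els (sg j) = map lam (mkseq (f j) (r j)).
  rewrite els_fs//; apply: (sorted_map_enum lamP).
  by rewrite sorted_map; apply: sub_sorted (iota_ltn_sorted _ _) => u v; exact: fh.
have sgn j k : (k < size (els (sg j)))%N -> nth 0 (els (sg j)) k = lam (f j k).
  rewrite sgE size_map size_mkseq => kr.
  by rewrite (nth_map 0%N) ?size_mkseq// nth_mkseq.
exists sg => j jl; split=> //.
- exact: rP.
- by split=> [|y /=]; [exact: rP|rewrite mem_fs => /mapP[i _ ->]].
- rewrite feltE sgn; last by rewrite size_els cardfs_gt0 F_neq0//; exact: rP.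
  by apply: selt_le => //; rewrite /f mul0n addn0; lia.
- move=> j' /andP[jj' j'l]; split=> k k1 k2; rewrite !sgn// ; apply: lamh; rewrite /f; nia.
Qed.

(** The same combination of the vectors [x (sg (g j))] is read twice: as a [k]-tuple, close to the
    right-hand side, and as a longer tuple with zeros off the range of [g], close to the left-hand
    side. Both errors vanish as [l] grows. *)
Lemma generates_spread k (c : nat -> R) (g : nat -> nat) :
  (forall i j, (i < j < k)%N -> (g i < g j)%N) ->
  p (\sum_(0 <= j < k) c j *: e (g j)) = p (\sum_(0 <= j < k) c j *: e j).
Proof.
move=> gh; pose N := (\sum_(0 <= j < k) (g j).+1)%N.
have gN j : (j < k)%N -> (g j < N)%N.
  move=> jk; rewrite /N (bigD1_seq j) ?mem_index_iota ?iota_uniq//=; lia.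
pose c1 i := \sum_(0 <= j < k) (if g j == i then c j else 0).
have c1E (W : lmodType R) (w : nat -> W) :
    \sum_(0 <= i < N) c1 i *: w i = \sum_(0 <= j < k) c j *: w (g j).
  under eq_bigr do rewrite scaler_suml.
  rewrite exchange_big/=; apply: eq_big_nat => j /andP[_ jk].
  rewrite (bigD1_seq (g j)) ?mem_index_iota ?iota_uniq ?gN//= eqxx.
  by rewrite big1 ?addr0// => i /negbTE; rewrite eq_sym => ->; rewrite scale0r.
pose B := 1 + \sum_(0 <= j < k) `|c j|.
have S0 : 0 <= \sum_(0 <= j < k) `|c j| by rewrite sumr_ge0.
have B0 : 0 < B by rewrite /B; lra.
apply/eqP; rewrite -subr_eq0 -normr_le0; apply/ler_addgt0Pl => eps eps0; rewrite addr0.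
have eps2 : 0 < eps / 2 by lra.
have [n0 Hn0] := delta_small eps2 B0.
pose l := maxn n0 (maxn k N).
have {}Hn0 := Hn0 l (leq_maxl _ _).
have [sg sgP] := long_plegma l.
have Nl : (N <= l)%N by rewrite /l; lia.
have kl : (k <= l)%N by rewrite /l; lia.
have nthE n i : (i < n)%N -> nth 0%N (index_iota 0 n) i = i.
  by move=> ni; rewrite nth_iota ?subn0// add0n.
have cB j : (j < k)%N -> `|c j| <= B.
  move=> jk; rewrite /B (bigD1_seq j) ?mem_index_iota ?iota_uniq//=.
  rewrite addrCA lerDl addr_ge0// sumr_ge0//.
have H1 : `| `|\sum_(0 <= j < k) c j *: x (sg (g j))| - p (\sum_(0 <= j < k) c j *: e j)|
    <= B * delta l.
  have := @generates_seq nat 0%N (index_iota 0 k) c (sg \o g) l B B0.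
  rewrite size_iota subn0 (_ : \sum_(0 <= j < k) c (nth 0%N (index_iota 0 k) j) *: e j =
    \sum_(0 <= j < k) c j *: e j); last first.
    by apply: eq_big_nat => j /andP[_ jk]; rewrite nthE.
  apply=> //.
  - move=> i ik; rewrite nthE//=; have [? ? ? _] := sgP (g i) (leq_trans (gN i ik) Nl).
    by split=> //; [exact: F_neq0|exact: cB].
  - move=> i j /andP[ij jk]; have ik := ltn_trans ij jk; rewrite !nthE//=.
    have [_ _ _] := sgP (g i) (leq_trans (gN i ik) Nl); apply.
    by rewrite gh ?ij// (leq_trans (gN j jk)).
have H2 : `| `|\sum_(0 <= i < N) c1 i *: x (sg i)| - p (\sum_(0 <= i < N) c1 i *: e i)|
    <= B * delta l.
  have := @generates_seq nat 0%N (index_iota 0 N) c1 sg l B B0.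
  rewrite size_iota subn0 (_ : \sum_(0 <= j < N) c1 (nth 0%N (index_iota 0 N) j) *: e j =
    \sum_(0 <= j < N) c1 j *: e j); last first.
    by apply: eq_big_nat => j /andP[_ jk]; rewrite nthE.
  apply=> //.
  - move=> i iN; rewrite nthE//=; have [? ? ? _] := sgP i (leq_trans iN Nl).
    split=> //; first exact: F_neq0.
    apply: le_trans (ler_norm_sum _ _ _) _.
    apply: (@le_trans _ _ (\sum_(0 <= j < k) `|c j|)).
      by apply: ler_sum => j _; case: ifP => //; rewrite normr0.
    by rewrite /B; lra.
  - move=> i j /andP[ij jN]; have iN := ltn_trans ij jN; rewrite !nthE//=.
    have [_ _ _] := sgP i (leq_trans iN Nl); apply.
    by rewrite ij (leq_trans jN).
move: H1 H2; rewrite !(c1E _ (x \o sg)) (c1E _ e) /=.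
set A := \sum_(0 <= j < k) c j *: x _ => H1 H2.
have := ler_normD (p (\sum_(0 <= j < k) c j *: e (g j)) - `|A|)
  (`|A| - p (\sum_(0 <= j < k) c j *: e j)).
rewrite subrKA [X in _ <= X + _]distrC => /le_trans; apply.
apply: le_trans (lerD H2 H1) _; lra.
Qed.

(** Spreading invariance frees the positions in [e] from the ranks in the list [Q], as the blocks
    [u] require. *)
Lemma generates_positions (T : Type) (q0 : T) (Q : seq T) (c : T -> R)
    (t : T -> {fset nat}) (g : T -> nat) (l : nat) (B : R) : 0 < B -> (size Q <= l)%N ->
  (forall i, (i < size Q)%N -> let q := nth q0 Q i in
    [/\ t q != fset0, restrict_family F M (t q),
      (selt M l <= felt (t q) 1)%N & `|c q| <= B]) ->
  (forall i j, (i < j < size Q)%N -> (g (nth q0 Q i) < g (nth q0 Q j))%N /\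
     plegma_rel (els (t (nth q0 Q i))) (els (t (nth q0 Q j)))) ->
  `| `|\sum_(q <- Q) c q *: x (t q)| - p (\sum_(q <- Q) c q *: e (g q)) | <= B * delta l.
Proof.
move=> B0 Ql QP Qpl.
rewrite [in X in _ - X](big_nth q0) (@generates_spread _ _ (fun j => g (nth q0 Q j))).
  by apply: generates_seq => // i j /Qpl[].
by move=> i j /Qpl[].
Qed.

End Generated.

(** * The spreading model of order xi + 1 *)

Section Shifts.
Variables (F : set {fset nat}) (lam b D : nat -> nat).
Hypotheses (rtF : regular_thin F) (Fn0 : F !=set0) (lamP : good_enum F lam).
Hypotheses (Dh : {homo D : i j / (i <= j)%N})
  (bD : forall q, (b q + 1 + D q.+1 <= b q.+1)%N).

Let lamh : {homo lam : i j / (i < j)%N}. Proof. by case: lamP. Qed.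

Lemma gap_homo : {homo b : i j / (i < j)%N}.
Proof. by apply: homo_ltn => [|q]; [exact: ltn_trans|have := bD q; lia]. Qed.

Definition sparse q := lam (b q).

Lemma sparse_homo : {homo sparse : i j / (i < j)%N}.
Proof. by move=> i j ij; apply: lamh; exact: gap_homo. Qed.

Definition sparse_idx y := xget 0%N [set q | sparse q = y].

Lemma sparseK : cancel sparse sparse_idx.
Proof.
move=> q; rewrite /sparse_idx; case: xgetP => [q' _ /(homo_ltn_inj sparse_homo)//|].
by move/(_ q); case.
Qed.

Lemma sparse_idx_lt y y' : range sparse y -> range sparse y' -> (y < y')%N ->
  (sparse_idx y < sparse_idx y')%N.
Proof.
move=> [q _ <-] [q' _ <-]; rewrite !sparseK; case: (ltngtP q q') => //.
  by move=> /sparse_homo; lia.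
by move=> ->; rewrite ltnn.
Qed.

(* For [y = lam (b q)] with [0 < q], the positions [shift_pos i y], [i < D q],
   lie in the gap between [b q.-1] and [b q]. *)
Definition shift_pos i y := ((b (sparse_idx y).-1).+1 + i)%N.

Lemma shift_pos_le i y : (0 < sparse_idx y)%N -> (i < D (sparse_idx y))%N ->
  (shift_pos i y <= b (sparse_idx y))%N.
Proof. by rewrite /shift_pos; case: (sparse_idx y) => // q _; have := bD q; rewrite /=; lia. Qed.

(** The image of [y] is at most [b (sparse_idx y)], and that of [y'] starts after the end of the
    previous gap, whatever [i'] is. *)
Lemma shift_pos_lt i i' y y' : range sparse y -> range sparse y' -> (y < y')%N ->
  (0 < sparse_idx y)%N -> (i < D (sparse_idx y))%N -> (shift_pos i y < shift_pos i' y')%N.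
Proof.
move=> ry ry' yy' y0 iD; have := shift_pos_le y0 iD.
have := sparse_idx_lt ry ry' yy'; rewrite {3}/shift_pos => lt.
have : (sparse_idx y <= (sparse_idx y').-1)%N by lia.
by move=> /(homo_ltn_leq gap_homo); lia.
Qed.

(* The initial segment in [F] of the shift of [l]; it exists when [fs l] is in
   [F] because the shift is pointwise below [l]. *)
Definition shift_set (l : seq nat) i : {fset nat} := xget fset0
  [set s | F s /\ exists r, s = fs (map lam (take r (map (shift_pos i) l)))].

(** The first point [n] decides how many shifts are allowed: later points have larger sparse
    indices, so, [D] being monotone, their gaps all have room for shift number [i]. *)
Lemma shift_setP n l i : sorted ltn (n :: l) -> F (fs l) ->
  (forall y, y \in n :: l -> range sparse y) -> (i < D (sparse_idx n).+1)%N ->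
  [/\ F (shift_set l i), (size (els (shift_set l i)) <= size l)%N &
    forall k, (k < size (els (shift_set l i)))%N ->
      nth 0%N (els (shift_set l i)) k = lam (shift_pos i (nth 0%N l k))].
Proof.
move=> snl Fl lr iD.
have sl := path_sorted snl.
have nl y : y \in l -> (sparse_idx n < sparse_idx y)%N.
  move=> yl; apply: sparse_idx_lt; [exact/lr/mem_head|by apply: lr; rewrite inE yl orbT|].
  by move: snl; rewrite sorted_ltn_cons => /andP[/allP/(_ _ yl)].
have lr' y : y \in l -> [/\ range sparse y, (0 < sparse_idx y)%N & (i < D (sparse_idx y))%N].
  move=> yl; split; first by apply: lr; rewrite inE yl orbT.
    exact: leq_ltn_trans (nl _ yl).
  by apply: leq_trans iD (Dh _); exact: nl.
have sj : sorted ltn (map (shift_pos i) l).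
  rewrite sorted_map; apply: (sub_in_sorted (P := mem l)) sl; last by apply/allP.
  by move=> y y' /lr'[? ? ?] /lr'[? ? ?] yy'; exact: shift_pos_lt.
have le k : (k < size l)%N -> (lam (nth 0%N (map (shift_pos i) l) k) <= nth 0%N l k)%N.
  move=> kl; rewrite (nth_map 0%N)//.
  have [[q _ qy] y0 yD] := lr' _ (mem_nth 0%N kl).
  rewrite -[X in (_ <= X)%N]qy -[q]sparseK qy; apply: (homo_ltn_leq lamh).
  exact: shift_pos_le.
have [r Fr] := cut_finite rtF Fn0 lamP sl Fl sj (size_map _ _) le.
have [Fs [r' sE]] : F (shift_set l i) /\
    exists r, shift_set l i = fs (map lam (take r (map (shift_pos i) l))).
  rewrite /shift_set; case: xgetP => [s _ //|].
  move/(_ (fs (map lam (take r (map (shift_pos i) l))))).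
  by case; split => //; exists r.
have st : sorted ltn (map lam (take r' (map (shift_pos i) l))).
  by apply: (sorted_map_enum lamP); exact: take_sorted.
rewrite sE els_fs// size_map -sE; split=> //.
  by rewrite size_take_min size_map geq_minr.
move=> k kt; rewrite (nth_map 0%N)// nth_take.
  by rewrite (nth_map 0%N)//; move: kt; rewrite size_take_min size_map leq_min => /andP[].
by move: kt; rewrite size_take_min leq_min => /andP[].
Qed.

End Shifts.

(** The combined family is listed in this order, a pair being a member of the plegma tuple and a
    shift number. *)
Definition lex (q q' : nat * nat) : bool :=
  (q.1 < q'.1)%N || ((q.1 == q'.1) && (q.2 < q'.2)%N).

Lemma pairwise_lex (f g : nat -> nat) js : sorted ltn js ->
  pairwise lex [seq (j, i) | j <- js, i <- index_iota (f j) (g j)].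
Proof.
elim: js => //= j js IH sj; rewrite pairwise_cat IH ?(path_sorted sj)// andbT.
apply/andP; split.
  apply/allrelP => _ _ /mapP[i _ ->] /allpairsPdep[j' [i' [j'js _ ->]]].
  by have /allP/(_ _ j'js) := order_path_min ltn_trans sj; rewrite /lex /= => ->.
rewrite pairwise_map; apply: sub_pairwise (_ : pairwise ltn _).
  by move=> i i' /=; rewrite /lex /= eqxx => ->; rewrite orbT.
by rewrite -(sorted_pairwise ltn_trans); exact: iota_ltn_sorted.
Qed.

Section SuccSpreadingModel.
Variables (R : realType) (X : normedModType R) (V : lmodType R) (p : V -> R) (e : nat -> V).
Variables (op : R -> R -> R) (pN : c00 R -> R).
Hypothesis opP : norm_op op.
Hypothesis pN_seminorm : is_seminorm pN.
Hypothesis pNE : forall k (a : nat -> R),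
  pN (\sum_(0 <= i < k) a i *: usual_basis R i) = bnorm op 0 k a.
(** The 3 cancels the factor in [almost_isometric]. Of the square, one power pays for the norm of at
    most [l0] coefficients in [-1, 1], the other leaves an error at most [1 / l0]. *)
Let eps (n : nat) : R := (3 * n.+1%:R ^+ 2)^-1.

(* For a plegma tuple [W 0, ..., W (k - 1)], [mm j] is the index in the sparse
   set of the first element of [W j] and [q1.+1] that of the second element of
   [W 0]; the estimates rest on [mm j <= q1] for all [j]. *)
Lemma spreading_model_succ xi u D : ole (osucc ozero) xi ->
  is_spreading_model X xi p e -> block_seq e D u -> almost_isometric p op eps u ->
  is_spreading_model X (osucc xi) pN (@usual_basis R).
Proof.
move=> xi1 [pP hE [F [M [x [rtF oF Mpos infM [delta [delta_gt0 delta_cvg0 deltaP]]]]]]] uD uI.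
have [Fn0 F0] : F !=set0 /\ ~ F fset0 by case: rtF => _ thF _; exact: order_pos oF xi1.
have [lam lamP Mlam] := good_enum_exists rtF Mpos infM.
have [lamh lam0 _] := lamP.
have Dh := block_seq_homo uD.
have /choice[c cE] : forall j, exists c, u j = \sum_(D j <= i < D j.+1) c i *: e i.
  by move=> j; have [_] := uD j.
pose B q : R := 1 + \sum_(0 <= m < q.+1) \sum_(D m <= i < D m.+1) `|c m i|.
have S0 q : 0 <= \sum_(0 <= m < q.+1) \sum_(D m <= i < D m.+1) `|c m i|.
  by apply: sumr_ge0 => m _; apply: sumr_ge0.
have B0 q : 0 < B q by rewrite /B; have := S0 q; lra.
have cB q m i : (m <= q)%N -> (D m <= i < D m.+1)%N -> `|c m i| <= B q.
  move=> mq mi; rewrite /B (bigD1_seq m) ?mem_index_iota ?iota_uniq//=.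
  rewrite (bigD1_seq i) ?mem_index_iota ?iota_uniq//= addrCA -addrA lerDl.
  rewrite addr_ge0 ?sumr_ge0// addr_ge0// sumr_ge0// => m' _; exact: sumr_ge0.
have /choice[ell ellP] : forall q, exists N, forall n, (N <= n)%N ->
    B q * delta n <= q.+1%:R^-1.
  by move=> q; apply: delta_small => //; rewrite invr_gt0.
(* Three demands on [b]: the gap before [b q] holds [D q] shifts; [b q >= ell q] controls the error
   [B q * delta (b q)]; and [b q >= D q.+1] will bound the size of the combined family. *)
pose b := fix b q := if q is q'.+1 then (b q' + 1 + D q + (ell q + D q.+1))%N
  else (ell 0%N + D 1%N)%N.
have bD q : (b q + 1 + D q.+1 <= b q.+1)%N by rewrite /=; lia.
have b_ell q : (ell q <= b q)%N by case: q => [|q] /=; lia.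
have b_D q : (D q.+1 <= b q)%N by case: q => [|q] /=; lia.
pose mu := sparse lam b; pose idx := sparse_idx lam b.
have muh : {homo mu : i j / (i < j)%N} by exact: (sparse_homo lamP bD).
have muK : cancel mu idx by exact: (sparseK lamP bD).
have mu0 n : (0 < mu n)%N by exact: lam0.
pose L : set nat := range mu.
pose m (v : {fset nat}) := idx (felt v 1).
pose t (v : {fset nat}) i := shift_set F lam b (behead (els v)) i.
(* The shift number [i] doubles as the position of the vector [e i] that [x (t v i)] imitates, so
   [x' v] imitates [u (m v)]. *)
pose x' v := \sum_(D (m v) <= i < D (m v).+1) c (m v) i *: x (t v i).
split=> //; first exact: hamel_usual_basis.
exists (succ_family F), L, x'; split.
- exact: regular_thin_succ.
- exact: has_order_succ.
- by move=> _ [q _ <-]; exact: mu0.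
- exact: infinite_range_homo.
(* Generation and almost isometry each contribute at most [1 / l0], and [2 / l0 <= 4 / l0.+1] since
   [l0 >= 1]. *)
exists (fun n => 4 * (n.+1%:R)^-1); split.
- by move=> n; rewrite mulr_gt0// invr_gt0.
- rewrite -[0](mulr0 4); apply: cvgMr; exact: cvg_harmonic.
move=> k l0 /andP[k1 kl0] v vpl vG head_v a a1.
have [v_ne vlt vcross] := vpl.
have vE (j : 'I_k) : exists n l, [/\ els (tnth v j) = n :: l, sorted ltn (n :: l), F (fs l) &
    forall y, y \in n :: l -> range mu y].
  have [[n [l [n0 snl Fl vnl]]] vL] := vG j.
  exists n, l; rewrite vnl els_fs//; split=> // y ynl.
  by apply: vL; rewrite vnl /= mem_fs.
pose W j := nth fset0 v j; pose mm j := m (W j).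
have WE (j : 'I_k) : tnth v j = W j by rewrite (tnth_nth fset0).
have {}vE j : (j < k)%N -> exists n l, [/\ els (W j) = n :: l, sorted ltn (n :: l), F (fs l) &
    forall y, y \in n :: l -> range mu y].
  by move=> jk; have := vE (Ordinal jk); rewrite WE.
have W2 j : (j < k)%N -> (1 < size (els (W j)))%N.
  move=> /vE[n [[|y l] [-> _ Fl _]]] //.
  by case: F0; rewrite -fs_nil.
have W1 j : (j < k)%N -> (0 < size (els (W j)))%N by move=> /W2/ltnW.
have feltL j i : (j < k)%N -> (i < size (els (W j)))%N -> range mu (felt (W j) i.+1).
  move=> /vE[n [l [El _ _ H]]] il; apply: H; rewrite feltE El; apply: mem_nth.
  by rewrite -El.
have {}vlt j j' i : (j < j' < k)%N -> (i < size (els (W j)))%N ->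
    (i < size (els (W j')))%N -> (felt (W j) i.+1 < felt (W j') i.+1)%N.
  move=> /andP[jj' j'k] ij ij'; have jk := ltn_trans jj' j'k.
  have := vlt (Ordinal jk) (Ordinal j'k) i.+1; rewrite !WE /=; apply => //.
  by rewrite leq_min -!size_els ij.
have {}vcross j j' i : (j < k)%N -> (j' < k)%N -> (i < size (els (W j)))%N ->
    (i.+1 < size (els (W j')))%N -> (felt (W j) i.+1 < felt (W j') i.+2)%N.
  move=> jk j'k ij ij'.
  have := vcross (Ordinal jk) (Ordinal j'k) i.+1; rewrite !WE /=; apply.
  by rewrite leq_min -!size_els ij ltn_subRL add1n.
have idx_lt y y' : range mu y -> range mu y' -> (y < y')%N -> (idx y < idx y')%N.
  exact: (sparse_idx_lt lamP bD).
have mm_lt j j' : (j < j' < k)%N -> (mm j < mm j')%N.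
  move=> /andP[jj' j'k]; have jk := ltn_trans jj' j'k.
  by apply: idx_lt; [apply: feltL; auto..|apply: vlt; rewrite ?jj'; auto].
have mm_lt2 j j' i : (j < k)%N -> (j' < k)%N -> (i.+1 < size (els (W j')))%N ->
    (mm j < idx (felt (W j') i.+2))%N.
  move=> jk j'k ij'; apply: (@leq_trans (idx (felt (W j') 2))).
    by apply: idx_lt; [apply: feltL; auto..|apply: vcross; auto].
  case: i ij' => // i ij'; apply: ltnW; apply: idx_lt; [apply: feltL; auto..|].
  have /(sorted_ltn_nth ltn_trans 0%N) := els_sorted (W j').
  by rewrite !feltE; apply; rewrite ?inE //; exact: W2.
pose q1 := (idx (felt (W 0) 2)).-1.
have q1E : idx (felt (W 0) 2) = q1.+1.
  by rewrite prednK//; apply: leq_ltn_trans (mm_lt2 0%N 0%N 0%N k1 k1 (W2 _ k1)).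
have mmq j : (j < k)%N -> (mm j <= q1)%N.
  by move=> jk; have := mm_lt2 _ _ 0%N jk k1 (W2 _ k1); rewrite q1E ltnS.
have q1_le j : (j < k)%N -> (q1 < idx (felt (W j) 2))%N.
  case: j => [|j] jk; first by rewrite q1E.
  rewrite -ltnS -q1E ltnS; apply: ltnW; apply: idx_lt; [apply: feltL; auto..|].
  by apply: vlt; auto.
have l0m : (l0 <= (mm 0).+1)%N.
  have l0E : l0 = l0.-1.+1 by rewrite prednK// (leq_trans k1).
  have : (mu l0.-1 <= mu (mm 0))%N.
    have [q _ qE] := feltL 0%N 0%N k1 (W1 _ k1).
    rewrite /mm /m -qE muK qE; move: head_v; rewrite {1}l0E (selt_range muh mu0).
    by rewrite -nth0.
  by move=> le; rewrite l0E ltnS leqNgt; apply/negP => /muh; rewrite ltnNge le.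
have tP j i : (j < k)%N -> (i < D (mm j).+1)%N ->
    [/\ F (t (W j) i), (size (els (t (W j) i)) < size (els (W j)))%N &
    forall h, (h < size (els (t (W j) i)))%N ->
      nth 0%N (els (t (W j) i)) h = lam (shift_pos lam b i (felt (W j) h.+2))].
  move=> jk; rewrite /mm /m /t; have [n [l [El snl Fl rl]]] := vE j jk.
  rewrite feltE El /= => iD.
  have [Fs ss nths] := shift_setP rtF Fn0 lamP Dh bD snl Fl rl iD.
  by split=> // h hs; rewrite feltE El nths.
have t0 j i : (j < k)%N -> (i < D (mm j).+1)%N -> (0 < size (els (t (W j) i)))%N.
  by move=> jk iD; rewrite size_els cardfs_gt0; have [Ft _ _] := tP j i jk iD; exact: F_neq0 Ft.
have key j j' i i' h h' : (j < k)%N -> (i < D (mm j).+1)%N ->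
    (h.+1 < size (els (W j)))%N -> (j' < k)%N -> (h'.+1 < size (els (W j')))%N ->
    (felt (W j) h.+2 < felt (W j') h'.+2)%N ->
    (lam (shift_pos lam b i (felt (W j) h.+2)) < lam (shift_pos lam b i' (felt (W j') h'.+2)))%N.
  move=> jk iD hj j'k hj' lt; have lti := mm_lt2 j j h jk jk hj.
  apply: lamh; apply: (shift_pos_lt lamP bD) => //.
  - exact: feltL.
  - exact: feltL.
  - exact: leq_ltn_trans lti.
  - exact: leq_trans iD (Dh _ _ lti).
pose al i := if insub i is Some j then a j else 0 : R.
have alE (j : 'I_k) : al j = a j by rewrite /al valK.
have al1 i : `|al i| <= 1.
  by rewrite /al; case: insub => [j|]; rewrite ?normr0// ler_norml.
pose Q := [seq (j, i) | j <- iota 0 k, i <- index_iota (D (mm j)) (D (mm j).+1)].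
have QP i0 : (i0 < size Q)%N -> let q := nth (0, 0)%N Q i0 in
    (q.1 < k)%N /\ (D (mm q.1) <= q.2 < D (mm q.1).+1)%N.
  move=> /(mem_nth (0, 0)%N)/allpairsPdep[j [i [jk iD ->]]] /=.
  by move: jk iD; rewrite mem_iota mem_index_iota add0n.
have Qlex i0 i1 : (i0 < i1 < size Q)%N -> lex (nth (0, 0)%N Q i0) (nth (0, 0)%N Q i1).
  move=> /andP[i01 i1Q].
  have /(pairwiseP (0, 0)%N) := pairwise_lex (fun j => D (mm j)) (fun j => D (mm j).+1)
    (iota_ltn_sorted 0 k).
  by apply => //; rewrite inE// (ltn_trans i01).
(* Between different members, [key] transfers the plegma inequalities of [W]. Between two shifts of
   one member, points of equal rank share a gap and are ordered by the shift number. *)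
have Qpl i0 i1 : (i0 < i1 < size Q)%N ->
    ((nth (0, 0)%N Q i0).2 < (nth (0, 0)%N Q i1).2)%N /\
    plegma_rel (els (t (W (nth (0, 0)%N Q i0).1) (nth (0, 0)%N Q i0).2))
      (els (t (W (nth (0, 0)%N Q i1).1) (nth (0, 0)%N Q i1).2)).
  move=> i01; have := Qlex _ _ i01; have /andP[lt01 i1Q] := i01.
  have := QP _ i1Q; have := QP _ (ltn_trans lt01 i1Q).
  case: (nth _ Q i0) (nth _ Q i1) => [j i] [j' i'] /= [jk /andP[Di iD]] [j'k /andP[Di' i'D]].
  have [Ft st nt] := tP j i jk iD; have [Ft' st' nt'] := tP j' i' j'k i'D.
  rewrite /lex /= => /orP[jj'|/andP[/eqP jj' ii']].
    have jj'k : (j < j' < k)%N by rewrite jj'.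
    split; first by apply: leq_trans iD _; apply: leq_trans Di'; exact/Dh/mm_lt.
    split=> h h1 h2; rewrite ?nt ?nt'//.
    - by apply: key => //; [lia..|apply: vlt => //; lia].
    - by apply: key => //; [lia..|apply: vcross => //; lia].
    - by apply: key => //; [lia..|apply: vcross => //; lia].
  subst j'; split=> //; split=> h h1 h2; rewrite ?nt ?nt'//.
  - by apply: lamh; rewrite /shift_pos ltn_add2l.
  - by apply: key => //; [lia..|apply: vcross => //; lia].
  - by apply: key => //; [lia..|apply: vcross => //; lia].
(* The positions in [e] are distinct by [Qpl], and below [D q1.+1] because every [mm j] is at most
   [q1]. *)
have sizeQ : (size Q <= b q1)%N.
  apply: leq_trans (b_D q1); rewrite -(size_map snd) -[X in (_ <= X)%N](size_iota 0).
  apply: uniq_leq_size.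
    have : sorted ltn (map snd Q).
      rewrite (sorted_pairwise ltn_trans); apply/(pairwiseP 0%N) => i0 i1.
      rewrite !inE size_map => i0Q i1Q i01; rewrite !(nth_map (0, 0)%N)//.
      by case: (Qpl i0 i1); rewrite ?i01.
    by rewrite ltn_sorted_uniq_leq => /andP[].
  move=> _ /mapP[q /(nthP (0, 0)%N)[i0 i0Q <-] ->].
  have [jk /andP[_ iD]] := QP _ i0Q; rewrite mem_iota add0n /=.
  by apply: leq_trans iD (Dh _ _ _); rewrite ltnS mmq.
pose cf (q : nat * nat) := al q.1 * c (mm q.1) q.2.
have est := @generates_positions R X F M x V p e pP delta delta_gt0 deltaP delta_cvg0
  rtF Fn0 F0 lam lamP Mlam _ (0, 0)%N Q cf (fun q => t (W q.1) q.2) snd (b q1) (B q1)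
  (B0 q1) sizeQ.
have {est} : `| `|\sum_(q <- Q) cf q *: x (t (W q.1) q.2)| - p (\sum_(q <- Q) cf q *: e q.2)|
    <= B q1 * delta (b q1).
  apply: est => [i0 i0Q q|i0 i1 i01]; last exact: Qpl.
  have [jk iD] := QP _ i0Q; have /andP[_ iD2] := iD.
  have [Ft st nt] := tP q.1 q.2 jk iD2; have ts0 := t0 q.1 q.2 jk iD2.
  split.
  - exact: F_neq0 Ft.
  - split=> // y /=; rewrite -mem_els => /(nthP 0%N)[h hs <-].
    by rewrite nt//; exact: Mlam.
  - rewrite feltE nt//; apply: selt_le => //.
    rewrite /shift_pos; have : (q1 <= (idx (felt (W q.1) 2)).-1)%N.
      by have := q1_le _ jk; case: (idx _).
    move=> /(homo_ltn_leq (gap_homo bD)) le; apply: leq_trans le _.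
    by rewrite -addnS addSnnS leq_addr.
  - rewrite /cf normrM -[X in _ <= X]mul1r ler_pM//.
    by apply: cB => //; exact: mmq.
have -> : \sum_(q <- Q) cf q *: x (t (W q.1) q.2) = \sum_(j < k) a j *: x' (tnth v j).
  rewrite big_allpairs_dep/= (_ : iota 0 k = index_iota 0 k); last by rewrite /index_iota subn0.
  rewrite big_mkord.
  apply: eq_bigr => j _; rewrite /cf /= alE WE /x' scaler_sumr.
  by apply: eq_bigr => i _; rewrite scalerA.
have -> : \sum_(q <- Q) cf q *: e q.2 = \sum_(0 <= j < k) al j *: u (mm j).
  rewrite big_allpairs_dep/= /index_iota subn0.
  apply: eq_bigr => j _; rewrite cE scaler_sumr.
  by apply: eq_bigr => i _; rewrite /cf /= scalerA.
have -> : pN (\sum_(j < k) a j *: usual_basis R j) = bnorm op 0 k al.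
  by rewrite -pNE big_mkord; congr pN; apply: eq_bigr => j _; rewrite alE.
(* Each [u (mm j)] is viewed as a normalised block running up to the next index, with coefficient 1
   at its start; the last block ends right after [mm k.-1]. The estimate on consecutive ranges then
   covers the sparse combination. *)
pose g j := if (j < k)%N then mm j else (mm k.-1).+1.
have gS j : (j < k)%N -> (mm j < g j.+1)%N.
  move=> jk; rewrite /g; case: (ltnP j.+1 k) => [j1k|kj]; first by apply: mm_lt; rewrite ltnSn.
  by rewrite ltnS (_ : k.-1 = j)//; lia.
have [|a' [g0k [a'u a'n]]] := @block_comb R op opP V u g (fun j i => (i == mm j)%:R) 0 k al isT.
  move=> j /= jk; rewrite {1 3}/g jk.
  have gj := gS j jk.
  split; first exact: ltnW.
  rewrite (@eq_bnorm _ _ _ _ _ (fun i => if (mm j <= i < (mm j).+1)%N then 1 else 0)).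
    by rewrite bnorm_restrict ?leqnn ?leqnSn// bnorm1// normr1.
  move=> i _; rewrite ltnS -eqn_leq eq_sym; by case: eqP.
have -> : \sum_(0 <= j < k) al j *: u (mm j) = \sum_(g 0%N <= i < g k) a' i *: u i.
  rewrite a'u; apply: eq_big_nat => j /andP[_ jk]; congr (_ *: _).
  have gj := gS j jk.
  rewrite {1}/g jk big_ltn// eqxx scale1r big1_seq ?addr0// => i.
  by rewrite mem_index_iota /= => /andP[ji _]; rewrite gtn_eqF// scale0r.
have g0 : g 0%N = mm 0%N by rewrite /g k1.
have := uI _ _ a' g0k; rewrite a'n (congr1 eps g0).
set P1 := p _; set N1 := bnorm _ _ _ _; set Z := `|\sum_(j < k) _|.
have N1k : N1 <= l0%:R.
  apply: le_trans (bnorm_le_sum opP _ _ _) _.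
  apply: (@le_trans _ _ (\sum_(0 <= i < k) 1)).
    by apply: ler_sum => i _; exact: al1.
  by rewrite sumr_const_nat subn0 ler_nat.
have l0_gt0 : 0 < l0%:R :> R by rewrite ltr0n (leq_trans k1).
have l0q : q1.+1%:R^-1 <= l0%:R^-1 :> R.
  by rewrite lef_pV2 ?posrE// ler_nat (leq_trans l0m)// ltnS mmq.
have eps_le : 3 * eps (mm 0) * N1 <= l0%:R^-1.
  rewrite /eps invfM mulrA divff ?mul1r// ?pnatr_eq0//.
  apply: (@le_trans _ _ ((l0%:R ^+ 2)^-1 * l0%:R)).
    rewrite ler_pM ?invr_ge0 ?exprn_ge0 ?bnorm_ge0//.
    by rewrite lef_pV2 ?posrE ?exprn_gt0// lerXn2r ?nnegrE// ler_nat.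
  by rewrite expr2 invfM -mulrA mulVf ?mulr1// gt_eqF.
have l0l0 : l0%:R^-1 + l0%:R^-1 <= 4 * (l0.+1%:R)^-1 :> R.
  have : l0%:R^-1 <= 2 / l0.+1%:R :> R.
    rewrite ler_pdivlMr ?ltr0n// ler_pdivrMl// -natr1.
    have : 1 <= l0%:R :> R by rewrite ler1n (leq_trans k1).
    lra.
  by move: (l0%:R^-1) (l0.+1%:R^-1) => r r' rr'; lra.
move=> H1 H2; apply: le_trans l0l0.
have := ler_normD (Z - P1) (P1 - N1); rewrite subrKA => /le_trans; apply.
apply: lerD; last exact: le_trans H1 eps_le.
apply: le_trans H2 _; apply: le_trans l0q; exact: ellP.
Qed.

End SuccSpreadingModel.

(** The argument common to l^1 and c_0; [james] stands for the distortion step, proved separately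
    for each. *)
Lemma spreading_model_of_copy (R : realType) (X : normedModType R) (xi : cord)
    (V : lmodType R) (p : V -> R) (e : nat -> V) (E Y : normedModType R)
    (iota : {linear V -> E}) (op : R -> R -> R) (y : nat -> Y) (pN : c00 R -> R) :
  norm_op op ->
  (forall c C w D eps, is_seminorm p -> (forall n, 0 < eps n) ->
    (forall i j, (i <= j)%N -> eps j <= eps i) -> 0 < c ->
    equiv_seq p op c C w -> block_seq e D w ->
    exists u D', block_seq e D' u /\ almost_isometric p op eps u) ->
  (forall n m a, (n <= m)%N -> `|\sum_(n <= i < m) a i *: y i| = bnorm op n m a) ->
  is_seminorm pN ->
  (forall k a, pN (\sum_(0 <= i < k) a i *: usual_basis R i) = bnorm op 0 k a) ->
  ole (osucc ozero) xi -> is_spreading_model X xi p e ->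
  (forall v, `|iota v| = p v) -> dense (range iota) ->
  contains_isomorphic_copy Y E ->
  is_spreading_model X (osucc xi) pN (@usual_basis R).
Proof.
move=> opP james yN pNs pNE xi1 sm iotap dE copy.
have [pP [_ eV] _] := sm.
have spanE x : exists n, inspan e 0 n x.
  have [n [a ->]] := eV x; exists n, (fun i => if insub i is Some j then a j else 0).
  by rewrite big_mkord; apply: eq_bigr => j _; rewrite valK.
have [c [C [v [c0 vE]]]] := copy_equiv_seq opP iotap dE yN copy.
have [w [D [wD wE]]] := block_equiv_exist opP spanE vE.
have [|i j ij|u [D' [uD' uI]]] :=
    james c C w D (fun n => (3 * n.+1%:R ^+ 2)^-1) pP _ _ c0 wE wD.
- by move=> n; rewrite invr_gt0 mulr_gt0// exprn_gt0.
- rewrite lef_pV2 ?posrE ?mulr_gt0 ?exprn_gt0// ler_pM2l//.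
  by rewrite lerXn2r ?nnegrE// ler_nat.
refine (spreading_model_succ opP pNs pNE xi1 sm uD' uI).
Qed.

Theorem proposition0p21 (R : realType) (X : completeNormedModType R)
    (xi : cord) (V : lmodType R) (p : V -> R) (e : nat -> V)
    (E : completeNormedModType R) (iota : {linear V -> E}) :
  ole (osucc ozero) xi ->
  is_spreading_model X xi p e ->
  is_completion p iota ->
  (contains_isomorphic_copy (ell1 R) E ->
     is_spreading_model X (osucc xi)
       (fun x : c00 R => ell1_norm x) (@usual_basis R)) /\
  (contains_isomorphic_copy (c0 R) E ->
     is_spreading_model X (osucc xi)
       (fun x : c00 R => sup_norm x) (@usual_basis R)).
Proof.
move=> xi1 sm [iotap dE]; split.
- apply: (spreading_model_of_copy (norm_op_add R) _ (@norm_ell1_basis R)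
    (seminorm_ell1 R) _ xi1 sm iotap dE).
    move=> c C w D eps pP e0 en c0 wE wD.
    exact (almost_isometric_add pP e0 en c0 wE wD).
  move=> k a; apply: ell1_norm_bnorm => // i; exact: c00_sumE.
- apply: (spreading_model_of_copy (norm_op_max R) _ (@norm_c0_basis R)
    (seminorm_sup R) _ xi1 sm iotap dE).
    move=> c C w D eps pP e0 en c0 wE wD.
    exact (almost_isometric_max pP e0 en c0 wE wD).
  move=> k a; apply: sup_norm_bnorm => // i; exact: c00_sumE.
Qed.
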